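(* Let $n\ge1$, $T>0$, and let $B\subset\mathbb{R}^n$ be a bounded open subset. Let $C_P>0$ be a Poincaré inequality constant such that $\|\varphi\|_{L^2(B)}\le C_P\|\Delta\varphi\|_{L^2(B)}$ for all $\varphi\in C_c^\infty(B)$. If $u_0\in L^2(\mathbb{R}^n)$ with $\operatorname{supp}(u_0)\subseteq B$ and $u$ is the corresponding solution of the heat equation in $\mathbb{R}^n\times(0,T)$ with initial condition $u_0$, then $$\|u_0\|_{H^{-2}(B)}\le C\,\|u\|_{L^2(B\times(0,T))},\qquad\text{with } C=C_PT^{-1/2}+T^{1/2}.$$
   Context: The heat equation problem with initial condition $u_0$ is $$u_t-\Delta u=0 \text{ in }\mathbb{R}^n\times(0,T),\qquad u(y,0)=u_0(y)\text{ in }\mathbb{R}^n,\qquad \lim_{|y|\to\infty}u(y,t)=0 \text{ for } t\in(0,T),$$ and its solution is $u(\cdot,t)=e^{t\Delta}u_0$ (convolution of $u_0$ with the heat kernel $(4\pi t)^{-n/2}e^{-|y|^2/(4t)}$). $H^2_0(B)$ is the completion of $C_c^\infty(B)$ with respect to the $H^2$-norm, equipped with the equivalent norm $\|\varphi\|_{H^2_0(B)}=\|\Delta\varphi\|_{L^2(B)}$, and $H^{-2}(B)$ is its topological dual with the dual norm; $u_0$ is regarded as the functional $\varphi\mapsto\int_B u_0\varphi\,dx$. *)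

(* Defs.v *)
From HB Require Import structures.
From mathcomp Require Import all_boot all_order all_algebra.
From mathcomp Require Import all_classical all_reals all_analysis.

Set Implicit Arguments.
Unset Strict Implicit.
Unset Printing Implicit Defensive.

Import Order.TTheory GRing.Theory Num.Theory.
Import numFieldNormedType.Exports.

Local Open Scope classical_set_scope.
Local Open Scope ring_scope.

(* R^n is 'rV[R]_n. Its sigma-algebra is generated by the coordinate
   projections; for T = R this is the Borel sigma-algebra of R^n. *)
Definition measure_rV_display : measure_display -> measure_display.
Proof. exact. Qed.

Section measurable_rV.
Context {d} {T : sigmaRingType d}.
Variable n : nat.

Let coors : 'I_n -> 'rV[T]_n -> T := fun i x => x ord0 i.

Let rV_set0 : g_sigma_preimage coors set0.
Proof. exact: sigma_algebra0. Qed.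

Let rV_setC A : g_sigma_preimage coors A -> g_sigma_preimage coors (~` A).
Proof. exact: sigma_algebraC. Qed.

Let rV_bigcup (F : (set 'rV[T]_n)^nat) :
  (forall i, g_sigma_preimage coors (F i)) ->
  g_sigma_preimage coors (\bigcup_i (F i)).
Proof. exact: sigma_algebra_bigcup. Qed.

HB.instance Definition _ := @isMeasurable.Build (measure_rV_display d)
  'rV[T]_n (g_sigma_preimage coors) rV_set0 rV_setC rV_bigcup.

End measurable_rV.

Lemma measurable_coord_rV d (T : sigmaRingType d) n (i : 'I_n) :
  measurable_fun [set: 'rV[T]_n] (fun x => x ord0 i).
Proof.
move=> _ Y mY; rewrite setTI; apply: sub_sigma_algebra => /=.
rewrite -bigcup_seq/=; exists i => /=; first by rewrite mem_index_enum.
by exists Y => //; rewrite setTI.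
Qed.

Lemma measurable_fun_rVP d d' (S : measurableType d) (T : measurableType d') n
    (f : S -> 'rV[T]_n) :
  (forall i, measurable_fun [set: S] (fun x => f x ord0 i)) ->
  measurable_fun [set: S] f.
Proof.
move=> mf; pose coors := fun (i : 'I_n) (x : 'rV[T]_n) => x ord0 i.
suff H : g_sigma_preimage (fun i => coors i \o f) `<=` measurable.
  move=> _ A mA; apply: H; rewrite g_sigma_preimage_comp.
  by exists A.
apply: smallest_sub; first exact: sigma_algebra_measurable.
rewrite -bigcup_seq/= => A/= [i _ [B mB <-]].
exact: mf.
Qed.

Section lebesgue_rV.
Context {R : realType}.
Local Open Scope ereal_scope.

Definition rV_cons n (p : R * 'rV[R]_n) : 'rV[R]_n.+1 :=
  row_mx (p.1%:M : 'rV[R]_1) p.2.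

Definition rV_uncons n (x : 'rV[R]_n.+1) : R * 'rV[R]_n :=
  (x ord0 ord0, rsubmx (x : 'rV[R]_(1 + n))).

Lemma rV_consK n : cancel (@rV_cons n) (@rV_uncons n).
Proof.
move=> [a x]; rewrite /rV_uncons /rV_cons/= row_mxKr; congr (_, _).
have -> : (ord0 : 'I_n.+1) = lshift n (ord0 : 'I_1) by exact: val_inj.
by rewrite (row_mxEl (a%:M : 'rV_1) x) !mxE.
Qed.

Lemma measurable_rV_cons n : measurable_fun setT (@rV_cons n).
Proof.
apply: measurable_fun_rVP => i; rewrite /rV_cons.
case: (@split_ordP 1 n i) => j -> /=.
- apply: (eq_measurable_fun fst); last exact: measurable_fst.
  by move=> p _; rewrite (row_mxEl (p.1%:M : 'rV_1)) !ord1 !mxE.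
- apply: (eq_measurable_fun ((fun x : 'rV[R]_n => x ord0 j) \o snd)).
    by move=> p _; rewrite /= (row_mxEr (p.1%:M : 'rV_1)).
  by apply: measurableT_comp; [exact: measurable_coord_rV|exact: measurable_snd].
Qed.

Lemma measurable_rV_uncons n : measurable_fun setT (@rV_uncons n).
Proof.
apply/measurable_fun_pair => /=; first exact: measurable_coord_rV.
apply: measurable_fun_rVP => i.
apply: (eq_measurable_fun (fun x : 'rV[R]_n.+1 => x ord0 (rshift 1 i))).
  by move=> x _; rewrite mxE.
exact: measurable_coord_rV.
Qed.

Section step.
Variables (n : nat) (m : {sigma_finite_measure set 'rV[R]_n -> \bar R}).

Definition lebesgue_rV_step : set 'rV[R]_n.+1 -> \bar R :=
  pushforward (@lebesgue_measure R \x m) (@rV_cons n).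

Let prodm : measure _ _ :=
  @lebesgue_measure R \x m.

Let mcons A : measurable A -> measurable (@rV_cons n @^-1` A).
Proof. by move=> mA; rewrite -[X in measurable X]setTI; exact: measurable_rV_cons. Qed.

Let step0 : lebesgue_rV_step set0 = 0.
Proof. by rewrite /lebesgue_rV_step /pushforward preimage_set0 measure0. Qed.

Let step_ge0 A : 0 <= lebesgue_rV_step A.
Proof. exact: (measure_ge0 prodm). Qed.

Let step_sigma_additive : semi_sigma_additive lebesgue_rV_step.
Proof.
move=> F mF tF mUF; rewrite /lebesgue_rV_step /pushforward preimage_bigcup.
apply: (measure_semi_sigma_additive (s := prodm)).
- by move=> k; exact: mcons.
- apply/trivIsetP => /= i j _ _ ij; rewrite -preimage_setI.
  by move/trivIsetP : tF => /(_ _ _ _ _ ij) ->//; rewrite preimage_set0.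
- by rewrite -preimage_bigcup; exact: mcons.
Qed.

HB.instance Definition _ := isMeasure.Build _ _ _ lebesgue_rV_step
  step0 step_ge0 step_sigma_additive.

Let step_sigma_finite : sigma_finite setT lebesgue_rV_step.
Proof.
have /sigma_finiteP[F [FT ndF Foo]] := sigma_finiteT (@lebesgue_measure R).
have /sigma_finiteP[G [GT ndG Goo]] := sigma_finiteT m.
exists (fun k => @rV_uncons n @^-1` (F k `*` G k)).
  apply/esym/seteqP; split => // x _; rewrite -preimage_bigcup /=.
  have [k _ Fk] : (\bigcup_k F k) (rV_uncons x).1 by rewrite -FT.
  have [l _ Gl] : (\bigcup_k G k) (rV_uncons x).2 by rewrite -GT.
  exists (maxn k l) => //; split.
  - by move: Fk; exact/subsetPset/ndF/leq_maxl.
  - by move: Gl; exact/subsetPset/ndG/leq_maxr.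
move=> k; have [mFk Fk] := Foo k; have [mGk Gk] := Goo k; split.
  rewrite -[X in measurable X]setTI; apply: measurable_rV_uncons => //.
  exact: measurableX.
rewrite /lebesgue_rV_step /pushforward -comp_preimage.
rewrite (_ : _ \o _ = id) ?preimage_id; last first.
  by apply/funext => p /=; rewrite rV_consK.
by rewrite product_measure1E// lte_mul_pinfty// ge0_fin_numE.
Qed.

HB.instance Definition _ := Measure_isSigmaFinite.Build _ _ _ lebesgue_rV_step
  step_sigma_finite.

End step.

(* n-dimensional Lebesgue measure: the n-fold product of the Lebesgue measure
   of R, transported to 'rV[R]_n. *)
Fixpoint lebesgue_rV n : {sigma_finite_measure set 'rV[R]_n -> \bar R} :=
  match n with
  | 0%N => dirac (0%R : 'rV[R]_0)
  | m.+1 => lebesgue_rV_step (lebesgue_rV m)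
  end.

Lemma lebesgue_rV_box n (A : 'I_n -> set R) : (forall i, measurable (A i)) ->
  lebesgue_rV n [set x | forall i, A i (x ord0 i)] =
  \prod_(i < n) lebesgue_measure (A i).
Proof.
elim: n A => [|n IH] A mA.
  by rewrite big_ord0 /= diracE mem_set// => -[].
rewrite big_ord_recl -IH; last by move=> i; exact: mA.
have mB : measurable [set x : 'rV[R]_n | forall i, A (lift ord0 i) (x ord0 i)].
  rewrite (_ : [set _ | _] = \bigcap_(i in [set: 'I_n])
    ((fun x : 'rV[R]_n => x ord0 i) @^-1` A (lift ord0 i))); last first.
    by apply/seteqP; split => x /= xA i; [move=> _|]; exact: xA.
  apply: fin_bigcap_measurable => // i _; rewrite -[X in measurable X]setTI.
  exact: measurable_coord_rV.
have rV_cons0 a x : @rV_cons n (a, x) ord0 ord0 = a.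
  by have := rV_consK (a, x); rewrite /rV_uncons => -[].
have rV_consS a x j : @rV_cons n (a, x) ord0 (lift ord0 j) = x ord0 j.
  rewrite (_ : lift ord0 j = rshift 1 j); last exact: val_inj.
  by rewrite /rV_cons (row_mxEr (a%:M : 'rV_1)).
rewrite -product_measure1E//=; last exact: mA.
rewrite /lebesgue_rV_step /pushforward.
congr (product_measure1 _ _ _); apply/seteqP; split => -[a x]/=.
  move=> H; split => [|i] /=; first by have := H ord0; rewrite rV_cons0.
  by have := H (lift ord0 i); rewrite rV_consS.
move=> [Aa Ax] i; case: (unliftP ord0 i) => [j ->|->].
  by rewrite rV_consS; exact: Ax.
by rewrite rV_cons0.
Qed.

End lebesgue_rV.

Section function_spaces.
Context {R : realType} {n : nat}.
Local Notation V := 'rV[R]_n.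
Local Notation mu := (lebesgue_rV n : {measure set V -> \bar R}).
Implicit Types (B : set V) (f phi : V -> R) (i j : 'I_n).

Definition partial i f : V -> R := fun x => 'D_(delta_mx ord0 i : V) f x.

(* the mixed partial derivative along the list s of directions *)
Definition iter_partial (s : seq 'I_n) f : V -> R := foldr partial f s.

Definition smooth f := forall s : seq 'I_n,
  continuous (iter_partial s f) /\
  forall i x, derivable (iter_partial s f) x (delta_mx ord0 i : V).

Definition laplacian f : V -> R := fun x => \sum_(i < n) partial i (partial i f) x.

Definition tsupport f : set V := closure [set x | f x != 0].

(* C_c^oo(B), as functions on R^n *)
Definition test_function B : set (V -> R) :=
  [set phi | [/\ smooth phi, compact (tsupport phi) & tsupport phi `<=` B]].

(* the support of an element of L^2, which does not depend on the
   representative: the complement of the largest open set on which f = 0 a.e. *)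
Definition ess_support f : set V :=
  ~` \bigcup_(U in [set U | open U /\ {ae mu, forall x, U x -> f x = 0}]) U.

Definition in_L2 B f := f \_ B \in Lfun mu 2%:E.

End function_spaces.

Definition L2norm d (T : measurableType d) (R : realType)
    (mu : {measure set T -> \bar R}) (D : set T) (f : T -> R) : \bar R :=
  'N[mu]_2%:E[EFin \o (f \_ D)]%E.

(* H^2_0(B) is realised as the closure of the image of C_c^oo(B) under
   phi |-> (phi, grad phi, hess phi) in a finite power of L^2(B). This map is
   isometric for the H^2-norm (with the Euclidean norm of the Hessian) and the
   target space is complete, so the closure is the completion of C_c^oo(B). *)
Record jet2 (R : realType) (n : nat) := Jet2 {
  jval : 'rV[R]_n -> R ;
  jgrad : 'I_n -> 'rV[R]_n -> R ;
  jhess : 'I_n -> 'I_n -> 'rV[R]_n -> R }.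

Section H20.
Context {R : realType} {n : nat}.
Local Notation V := 'rV[R]_n.
Local Notation mu := (lebesgue_rV n : {measure set V -> \bar R}).
Implicit Types (B : set V) (phi : V -> R) (g h : jet2 R n).

Definition jet2_of phi : jet2 R n :=
  Jet2 phi (fun i => partial i phi) (fun i j => partial i (partial j phi)).

Definition jet2_sub g h : jet2 R n :=
  Jet2 (jval g \- jval h) (fun i => jgrad g i \- jgrad h i)
       (fun i j => jhess g i j \- jhess h i j).

Definition jlaplacian g : V -> R := fun x => \sum_(i < n) jhess g i i x.

Definition H2norm B g : \bar R :=
  ((L2norm mu B (jval g) ^+ 2
    + \sum_(i < n) L2norm mu B (jgrad g i) ^+ 2
    + \sum_(i < n) \sum_(j < n) L2norm mu B (jhess g i j) ^+ 2) `^ 2^-1)%E.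

Definition H20 B : set (jet2 R n) := [set g |
  [/\ in_L2 B (jval g), forall i, in_L2 B (jgrad g i),
      forall i j, in_L2 B (jhess g i j) &
      exists phi_ : (V -> R)^nat, (forall k, test_function B (phi_ k)) /\
        H2norm B (jet2_sub (jet2_of (phi_ k)) g) @[k --> \oo] --> 0%E]].

Definition H20norm B g : \bar R := L2norm mu B (jlaplacian g).

(* the dual norm of H^{-2}(B), +oo when F is unbounded *)
Definition Hm2norm B (F : jet2 R n -> R) : \bar R :=
  ereal_sup [set `|F g|%:E | g in [set g | H20 B g /\ (H20norm B g <= 1)%E]].

(* a function regarded as the functional phi |-> \int_B u phi *)
Definition L2_functional B (u : V -> R) : jet2 R n -> R :=
  fun g => \int[mu]_(x in B) (u x * jval g x).

End H20.

Section heat.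
Context {R : realType} {n : nat}.
Local Notation V := 'rV[R]_n.
Local Notation mu := (lebesgue_rV n : {measure set V -> \bar R}).

(* the norm of 'rV[R]_n in the library is the sup norm *)
Definition sqnorm (x : V) : R := \sum_(i < n) x ord0 i ^+ 2.

Definition heat_kernel (t : R) (x : V) : R :=
  (4 * pi * t) `^ (- (n%:R / 2)) * expR (- sqnorm x / (4 * t)).

(* e^{t Delta} u0 *)
Definition heat_semigroup (t : R) (u0 : V -> R) : V -> R :=
  fun y => \int[mu]_z (heat_kernel t (y - z) * u0 z).

End heat.

(* Main.v *)
(** The proof is by duality with a test function that is affine in time. For
    [phi] in [C_c^oo(B)] put [psi(y, t) = phi(y) - (T - t) Delta phi(y)], which is
    [- (d/dt + Delta) ((T - t) phi)]. Integrating by parts against the heat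
    kernel gives [T phi(z) = int_0^T int K(t, y - z) psi(y, t) dy dt] for every
    [z]; multiplying by [u0(z)] and integrating, symmetry of the kernel and
    Fubini yield
      [T int u0 phi = int_0^T int_B u psi dy dt].
    Cauchy-Schwarz, [||psi|| <= T^(1/2) ||phi|| + T^(3/2) ||Delta phi||] and the
    Poincare inequality bound [|int u0 phi|] by [C ||u|| ||Delta phi||], and the
    bound passes to [H^2_0(B)] by density. *)

From HB Require Import structures.
Require Import Defs.
From mathcomp Require Import all_boot all_order all_algebra.
From mathcomp Require Import all_classical all_reals all_analysis.
From mathcomp Require Import measurable_realfun.
From mathcomp Require Import ring lra.

Import Order.TTheory GRing.Theory Num.Theory.
Import numFieldNormedType.Exports.

Local Open Scope classical_set_scope.
Local Open Scope ring_scope.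

Set Implicit Arguments.
Unset Strict Implicit.
Unset Printing Implicit Defensive.

(** * Borel sets and compactly supported functions on R^n *)

Section rV_measurability.
Context {R : realType}.

(** The supremum of the kernel at time [s] is of order [s^(-n/2)], so the integration by parts
    cannot be carried out directly down to [s = 0]. It is done on [[eps, T[], where the kernel terms
    multiplied by the compactly supported [phi] are bounded. Two facts insensitive to the
    singularity then give the limit: the kernel has mass 1 at every positive time, so the slab []0,
    eps[] contributes [O(eps)], and the boundary term at [eps] tends to [T phi(z)] because the
    kernel is an approximate identity.

    The weight [T - s] kills the boundary term at [s = T], and its derivative [-1] returns [phi]
    itself. All derivatives fall on the kernel and on [phi]; [u] enters only as a kernel integral,
    so [u0] in L^2 is enough.

    Dividing [C_P T^(1/2) + T^(3/2)] by [T] gives the two terms of [C]. In the density step, factors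
    depending on [n] and on the norm of [u0] appear, but they only multiply the H^2 distance to an
    approximating test function and vanish in the limit. *)

Lemma coord_le_norm n (x : 'rV[R]_n) i : `|x ord0 i| <= `|x|.
Proof.
rewrite [leRHS]/Num.norm/= mx_normrE.
by apply/bigmax_geP; right => /=; exists (ord0, i).
Qed.

Lemma measurable_rV_ball n (c : 'rV[R]_n) (r : R) : measurable (ball c r).
Proof.
have [r0|r0] := ltP 0 r; last first.
  rewrite (_ : ball c r = set0) //; apply/seteqP; split => // x [/=].
  by rewrite ltNge r0.
rewrite (_ : ball c r = \bigcap_(i in [set: 'I_n])
    ((fun x : 'rV[R]_n => x ord0 i) @^-1` ball (c ord0 i) r)); last first.
  apply/seteqP; split => x /=; first by move=> [_ xc] i _; exact: xc.
  by move=> xc; split => // i j; rewrite !ord1; exact: xc.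
apply: fin_bigcap_measurable => // i _; rewrite -[X in measurable X]setTI.
by apply: measurable_coord_rV => //; exact: measurable_ball.
Qed.

(** The sigma-algebra is generated by coordinates, so open sets are reached through second
    countability: [U] is a countable union of balls, which are boxes for the sup norm. *)
Lemma open_measurable_rV n (U : set 'rV[R]_n) : open U -> measurable U.
Proof.
move=> oU.
pose c (q : 'rV[rat]_n) : 'rV[R]_n := map_mx ratr q.
(* The index [k] encodes a rational centre and a radius [1/(m+1)]; a ball that is not contained in
   [U] is replaced by the empty set. *)
pose F (k : nat) : set 'rV[R]_n :=
  if unpickle k is Some (q, m) then
    if pselect (ball (c q) (m.+1%:R^-1) `<=` U) then ball (c q) (m.+1%:R^-1)
    else set0
  else set0.
have mF k : measurable (F k).
  rewrite /F; case: (unpickle k) => [[q m]|];last by [].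
  by case: pselect => [_|_] /=; [exact: measurable_rV_ball|exact: measurable0].
suff -> : U = \bigcup_k F k by apply: bigcup_measurable => k _; exact: mF.
apply/seteqP; split => [x Ux|x [k _]]; last first.
  rewrite /F; case: (unpickle k) => [[q m]|];last by [].
  by case: pselect => // s; exact: s.
have [e /= e0 exU] : nbhs_ball x U by apply/nbhs_ballP; exact: oU.
(* With a radius below [e / 2], a ball around a rational centre that contains [x] stays inside
   [ball x e]. *)
have [m me] : exists m : nat, m.+1%:R^-1 < e / 2.
  exists (Num.truncn ((e / 2)^-1)).
  rewrite invf_plt ?posrE ?divr_gt0//.
  by rewrite (lt_le_trans (truncnS_gt _)).
have m0 : 0 < m.+1%:R^-1 :> R by rewrite invr_gt0.
have qP i : {q : rat | ball (x ord0 i) (m.+1%:R^-1) (ratr q)}.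
  apply: cid.
  have [|y [yb [q _ qy]]] := @dense_rat R (ball (x ord0 i) m.+1%:R^-1) _ (ball_open _ _).
    by exists (x ord0 i); apply: ballxx.
  by exists q; rewrite qy.
pose q : 'rV[rat]_n := \row_i sval (qP i).
have xq : ball (c q) m.+1%:R^-1 x.
  split => // i j; rewrite !ord1 !mxE; apply: ball_sym; exact: (svalP (qP j)).
exists (pickle (q, m)) => //; rewrite /F pickleK.
case: pselect => // -[] y qy; apply: exU.
rewrite (splitr e); apply: (@ball_triangle _ _ (c q)).
  by apply: ball_sym; apply: le_ball xq; exact: ltW.
by apply: le_ball qy; exact: ltW.
Qed.

Lemma continuous_measurable_rV n (f : 'rV[R]_n -> R) :
  continuous f -> measurable_fun setT f.
Proof.
move=> /continuousP cf; apply: (measurability _ (RGenOpens.measurableE R)).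
move=> _ [_ [a [b ->] <-]]; rewrite setTI; apply: open_measurable_rV.
exact/cf/interval_open.
Qed.

(** Cubes carry all supports below: they are compact, and as products of intervals they have
    computable measure and slices that are again cubes. *)
Definition rV_cube n (M : R) : set 'rV[R]_n := [set x | forall i, x ord0 i \in `[- M, M]].
Arguments rV_cube : clear implicits.

Lemma measurable_rV_cube n M : measurable (rV_cube n M).
Proof.
rewrite (_ : rV_cube n M = \bigcap_(i in [set: 'I_n])
    ((fun x : 'rV[R]_n => x ord0 i) @^-1` `[- M, M])); last first.
  by apply/seteqP; split => x /= xM i; [move=> _|]; exact: xM.
apply: fin_bigcap_measurable => // i _; rewrite -[X in measurable X]setTI.
by apply: measurable_coord_rV => //; exact: measurable_itv.
Qed.

Lemma compact_rV_cube n M : compact (rV_cube n M).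
Proof.
by apply: (@rV_compact _ _ (fun=> `[- M, M]%classic)) => _; exact: segment_compact.
Qed.

Lemma lebesgue_rV_cube_lty n M : (lebesgue_rV n (rV_cube n M) < +oo)%E.
Proof.
rewrite (_ : rV_cube n M = [set x | forall i, `[- M, M]%classic (x ord0 i)])//.
rewrite (@lebesgue_rV_box _ _ (fun=> `[-M, M]%classic))// .
rewrite -ge0_fin_numE; last by apply: prode_ge0.
apply: prode_fin_num => i _; rewrite lebesgue_measure_itv/=.
by case: ifP.
Qed.

Lemma bounded_sub_cube n (B : set 'rV[R]_n) : bounded_set B ->
  exists2 M, 0 <= M & B `<=` rV_cube n M.
Proof.
move=> [M [Mr BM]]; exists (`|M| + 1); first by rewrite addr_ge0.
move=> x /(BM (`|M| + 1)) xM i /=; rewrite in_itv/= -ler_norml.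
apply: (le_trans (coord_le_norm x i)); apply: xM.
by rewrite (le_lt_trans (ler_norm M))// ltrDl.
Qed.

Lemma continuous_bounded_on_cube n M (f : 'rV[R]_n -> R) : continuous f ->
  exists2 C, 0 <= C & forall x, rV_cube n M x -> `|f x| <= C.
Proof.
move=> cf.
have : compact (f @` rV_cube n M).
  apply: continuous_compact; last exact: compact_rV_cube.
  by apply: continuous_subspaceT.
move/compact_bounded => [C [Cr fC]]; exists (`|C| + 1); first by rewrite addr_ge0.
move=> x xM; apply: (fC (`|C| + 1)); last by exists x.
by rewrite (le_lt_trans (ler_norm C))// ltrDl.
Qed.

Lemma cube_integrable n M C (f : 'rV[R]_n -> R) : measurable_fun setT f ->
  (forall x, `|f x| <= C) ->
  (forall x, ~ rV_cube n M x -> f x = 0) ->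
  (lebesgue_rV n).-integrable setT (EFin \o f).
Proof.
move=> mf fC f0.
have mc := @measurable_rV_cube n M.
rewrite (_ : EFin \o f = (EFin \o f) \_ (rV_cube n M)).
  apply/(integrable_mkcond _ mc).
  apply: measurable_bounded_integrable => //.
  - exact: lebesgue_rV_cube_lty.
  - exact: measurable_funTS.
  - exists C; split; first by exact: num_real.
    by move=> D CD x _; exact: le_trans (fC x) (ltW CD).
apply/funext => x; rewrite patchE; case: ifPn => // /negP; rewrite inE => /f0 /=.
by move=> ->.
Qed.

Lemma continuous_cube_bounded n M (f : 'rV[R]_n -> R) : continuous f ->
  (forall x, ~ rV_cube n M x -> f x = 0) ->
  exists2 C, 0 <= C & forall x, `|f x| <= C.
Proof.
move=> cf f0; have [C C0 fC] := continuous_bounded_on_cube M cf.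
exists C => // x; have [/fC //|/f0 ->] := pselect (rV_cube n M x).
by rewrite normr0.
Qed.

Lemma continuous_cube_integrable n M (f : 'rV[R]_n -> R) : continuous f ->
  (forall x, ~ rV_cube n M x -> f x = 0) ->
  (lebesgue_rV n).-integrable setT (EFin \o f).
Proof.
move=> cf f0; have [C C0 fC] := continuous_cube_bounded cf f0.
by apply: (@cube_integrable n M C) => //; exact: continuous_measurable_rV.
Qed.

End rV_measurability.

Arguments rV_cube {R} n M _.

(** * Integration on R^n by splitting off the first coordinate *)

Section rV_integration.
Context {R : realType}.

Lemma rV_consE0 n (a : R) (x : 'rV[R]_n) : rV_cons (a, x) ord0 ord0 = a.
Proof. by have := rV_consK (a, x); rewrite /rV_uncons => -[]. Qed.

Lemma rV_consES n (a : R) (x : 'rV[R]_n) j :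
  rV_cons (a, x) ord0 (lift ord0 j) = x ord0 j.
Proof.
rewrite (_ : lift ord0 j = rshift 1 j); last exact: val_inj.
by rewrite /rV_cons (row_mxEr (a%:M : 'rV_1)).
Qed.

Lemma measurable_fun_rV_cons d (S : measurableType d) n (f : 'rV[R]_n.+1 -> S) :
  measurable_fun setT f -> measurable_fun setT (f \o @rV_cons R n).
Proof. by move=> mf; apply: measurableT_comp => //; exact: measurable_rV_cons. Qed.

Lemma measurable_rV_prod n (f : 'I_n -> R -> R) :
  (forall i, measurable_fun setT (f i)) ->
  measurable_fun setT (fun x : 'rV[R]_n => \prod_(i < n) f i (x ord0 i)).
Proof.
move=> mf; apply: measurable_prod => i _.
by apply: measurableT_comp => //; exact: measurable_coord_rV.
Qed.

Local Open Scope ereal_scope.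

(** By construction [lebesgue_rV n.+1] is the image under [rV_cons] of a product measure, so this is
    a change of variables. It is the step of the inductions on the dimension. *)
Lemma ge0_integral_rVS n (f : 'rV[R]_n.+1 -> \bar R) :
  measurable_fun setT f -> (forall x, 0 <= f x) ->
  \int[lebesgue_rV n.+1]_x f x =
  \int[@lebesgue_measure R \x lebesgue_rV n]_p f (rV_cons p).
Proof.
move=> mf f0.
have mc := @measurable_rV_cons R n.
rewrite (eq_measure_integral (pushforward (@lebesgue_measure R \x lebesgue_rV n) (@rV_cons R n)))//.
by rewrite ge0_integral_pushforward.
Qed.

Lemma integrable_rVS n (f : 'rV[R]_n.+1 -> \bar R) :
  (lebesgue_rV n.+1).-integrable setT f ->
  (@lebesgue_measure R \x lebesgue_rV n).-integrable setT (f \o @rV_cons R n).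
Proof.
move=> /integrableP[mf foo]; apply/integrableP; split.
  exact: measurable_fun_rV_cons.
apply: le_lt_trans foo; rewrite (ge0_integral_rVS (f := abse \o f))//=.
exact: measurableT_comp.
Qed.

Lemma integral_rVS n (f : 'rV[R]_n.+1 -> \bar R) :
  (lebesgue_rV n.+1).-integrable setT f ->
  \int[lebesgue_rV n.+1]_x f x =
  \int[@lebesgue_measure R \x lebesgue_rV n]_p f (rV_cons p).
Proof.
move=> intf; have mf := measurable_int _ intf.
have mc := @measurable_rV_cons R n.
rewrite (eq_measure_integral (pushforward (@lebesgue_measure R \x lebesgue_rV n) (@rV_cons R n)))//.
by rewrite integral_pushforward// preimage_setT; exact: integrable_rVS.
Qed.

(** Tonelli, one coordinate at a time. It reduces the mass of the heat kernel to that of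
    one-dimensional Gaussians. *)
Lemma ge0_integral_rV_prod n (f : 'I_n -> R -> R) :
  (forall i, measurable_fun setT (f i)) -> (forall i x, (0 <= f i x)%R) ->
  \int[lebesgue_rV n]_x (\prod_(i < n) f i (x ord0 i))%:E =
  \prod_(i < n) \int[lebesgue_measure]_x (f i x)%:E.
Proof.
elim: n f => [|n IH] f mf f0.
  under eq_integral do rewrite big_ord0.
  by rewrite big_ord0 integral_cst// mul1e/= diracE mem_set.
rewrite ge0_integral_rVS//; last 2 first.
- by apply/measurable_EFinP; exact: measurable_rV_prod.
- by move=> x; rewrite lee_fin prodr_ge0.
have mp := measurable_rV_prod (fun i => mf (lift ord0 i)).
transitivity (\int[@lebesgue_measure R \x lebesgue_rV n]_p
    (f ord0 p.1 * \prod_(i < n) f (lift ord0 i) (p.2 ord0 i))%:E).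
  apply: eq_integral => -[a x] _; rewrite big_ord_recl rV_consE0.
  by under eq_bigr do rewrite rV_consES.
rewrite (fubini_tonelli1 (m1 := @lebesgue_measure R) (m2 := lebesgue_rV n)
  (fun p : R * 'rV[R]_n => (f ord0 p.1 * \prod_(i < n) f (lift ord0 i) (p.2 ord0 i))%:E))
  /fubini_F/=; last 2 first.
- apply/measurable_EFinP; apply: measurable_funM.
    by apply: measurableT_comp => //; exact: measurable_fst.
  by apply: (measurableT_comp mp); exact: measurable_snd.
- by move=> p; rewrite lee_fin mulr_ge0// prodr_ge0.
under eq_integral => a _.
  under eq_integral do rewrite EFinM.
  rewrite ge0_integralZl_EFin//; last 2 first.
  - by move=> x _; rewrite lee_fin prodr_ge0.
  - exact/measurable_EFinP.
  rewrite (IH (fun i => f (lift ord0 i)))//.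
  over.
have mE : measurable_fun [set: R] (fun x => (f ord0 x)%:E).
  exact/measurable_EFinP.
rewrite ge0_integralZr//.
- by rewrite big_ord_recl.
- by move=> x _; rewrite lee_fin.
- by apply: prode_ge0 => i _; apply: integral_ge0 => x _; rewrite lee_fin.
Qed.


End rV_integration.

(** * Integrals of partial derivatives of compactly supported functions *)

Section integral_partial.
Context {R : realType}.

Lemma continuous_rV_consl n (x : 'rV[R]_n) : continuous (fun a : R => rV_cons (a, x)).
Proof.
move=> a; apply/cvg_ballP => e e0; near=> b; split => // i j.
rewrite !ord1 {i}; case: (unliftP ord0 j) => [k|] ->.
  by rewrite !rV_consES; exact: ballxx.
rewrite !rV_consE0; near: b; apply/(nbhs_ballP a); exists e.
Unshelve. all: by end_near. Qed.

Lemma continuous_rV_consr n (a : R) : continuous (fun x : 'rV[R]_n => rV_cons (a, x)).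
Proof.
move=> x; have FF : Filter (nbhs x) by exact: nbhs_filter.
apply/(@cvg_ballP R _ _ (nbhs x) FF (fun x => rV_cons (a, x)) (rV_cons (a, x))) => e e0; near=> y; split => // i j.
rewrite !ord1 {i}; case: (unliftP ord0 j) => [k|] ->; last first.
  by rewrite !rV_consE0; exact: ballxx.
have : ball x e y by near: y; apply/(nbhs_ballP x); exists e.
by move=> [_ /(_ ord0 k)]; rewrite !rV_consES.
Unshelve. all: by end_near. Qed.

Lemma rV_cons_line0 n (a h : R) (x : 'rV[R]_n) :
  rV_cons (h + a, x) = h *: delta_mx ord0 ord0 + rV_cons (a, x).
Proof.
apply/rowP => j; rewrite [RHS]mxE [X in _ = X + _]mxE [X in _ * X]mxE; case: (unliftP ord0 j) => [k|] ->.
  by rewrite !rV_consES /= mulr0 add0r.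
by rewrite !rV_consE0 /= mulr1.
Qed.

Lemma rV_cons_lineS n (a h : R) (x : 'rV[R]_n) i :
  rV_cons (a, h *: delta_mx ord0 i + x) =
  h *: delta_mx ord0 (lift ord0 i) + rV_cons (a, x).
Proof.
apply/rowP => j; rewrite [RHS]mxE [X in _ = X + _]mxE [X in _ * X]mxE; case: (unliftP ord0 j) => [k|] ->.
  by rewrite !rV_consES !mxE (inj_eq lift_inj).
by rewrite !rV_consE0 /= mulr0 add0r.
Qed.

(** A directional derivative only sees the values along one line, so it can be transported between
    functions on different spaces. Derivatives of slices, of translates and of one-variable
    restrictions are all obtained this way. *)
Lemma is_derive_line (V : normedModType R) (f : V -> R) (x v : V) (d : R)
  (U : normedModType R) (g : U -> R) (y w : U) :
  (forall h : R, g (h *: w + y) = f (h *: v + x)) ->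
  is_derive x v f d -> is_derive y w g d.
Proof.
move=> gf [df dfE].
have g0 : g y = f x by have := gf 0; rewrite !scale0r !add0r.
have E : (fun h => h^-1 *: ((g \o shift y) (h *: w) - g y)) =
         (fun h => h^-1 *: ((f \o shift x) (h *: v) - f x)).
  by apply/funext => h /=; rewrite gf g0.
split; first by rewrite /derivable E.
by rewrite /derive E.
Qed.

Lemma integral_derive_compact_support (M : R) (G g : R -> R) :
  continuous g -> (forall a : R, is_derive a (1 : R) G (g a)) ->
  (forall a : R, a \notin `[- M, M] -> G a = 0) ->
  (forall a : R, a \notin `[- M, M] -> g a = 0) ->
  (\int[lebesgue_measure]_a (g a)%:E = 0)%E.
Proof.
move=> cg dG G0 g0.
(* Enlarging the interval puts both endpoints outside [[-M, M]], where [G] vanishes, and keeps it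
   nondegenerate even when [M] is not positive. *)
pose N : R := `|M| + 1.
have N0 : 0 < N by rewrite ltr_wpDl.
have notin (a : R) : N <= `|a| -> a \notin `[- M, M].
  move=> Na; rewrite in_itv/= -ler_norml -ltNge.
  by rewrite (lt_le_trans _ Na)// /N (le_lt_trans (ler_norm _))// ltrDl.
have -> : (\int[lebesgue_measure]_a (g a)%:E =
    \int[lebesgue_measure]_(a in `[(- N)%R, N]) (g a)%:E)%E.
  rewrite [RHS]integral_mkcond; apply: eq_integral => a _.
  rewrite patchE; case: ifPn => //; rewrite notin_setE/= in_itv/= -ler_norml.
  by move/negP; rewrite -ltNge => /ltW /notin /g0 ->.
have cG (a : R) : {for a, continuous G}.
  by apply: differentiable_continuous; apply/derivable1_diffP; case: (dG a).
rewrite (@continuous_FTC2 _ g G)//.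
- by rewrite !G0 ?subee// notin// ?normrN ger0_norm// ltW.
- by rewrite gtrN.
- exact: continuous_subspaceT.
- split.
  + by move=> a _; case: (dG a).
  + by apply: cvg_at_right_filter; exact: cG.
  + by apply: cvg_at_left_filter; exact: cG.
- by move=> a _; rewrite derive1E; case: (dG a).
Qed.

(* By induction on [n]: after Fubini, either the differentiated coordinate is the
   first one and the inner integral vanishes by the fundamental theorem of
   calculus, or the induction hypothesis applies to the inner integral. *)
Lemma integral_partial_compact_support n (i : 'I_n) (M : R) (F f : 'rV[R]_n -> R) :
  continuous f -> (forall x, is_derive x (delta_mx ord0 i : 'rV[R]_n) F (f x)) ->
  (forall x, ~ rV_cube n M x -> F x = 0) ->
  (forall x, ~ rV_cube n M x -> f x = 0) ->
  (\int[lebesgue_rV n]_x (f x)%:E = 0)%E.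
Proof.
elim: n i F f => [[]//|n IH] i F f cf dF F0 f0.
have intf := continuous_cube_integrable cf f0.
rewrite integral_rVS//.
have intg := integrable_rVS intf.
have ncube0 a (x : 'rV[R]_n) : a \notin `[- M, M] -> ~ rV_cube n.+1 M (rV_cons (a, x)).
  by move=> /negP aM /(_ ord0); rewrite rV_consE0.
have ncubeS a (x : 'rV[R]_n) : ~ rV_cube n M x -> ~ rV_cube n.+1 M (rV_cons (a, x)).
  by move=> xM axM; apply: xM => j; have := axM (lift ord0 j); rewrite rV_consES.
case: (unliftP ord0 i) => [j|] iE; subst i.
- rewrite -(integral12_prod_meas1 intg)/= /fubini_F.
  rewrite integral0_eq// => a _.
  apply: (IH j (fun x => F (rV_cons (a, x)))).
  + move=> x; apply: continuous_comp; [exact: continuous_rV_consr|exact: cf].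
  + move=> x; apply: is_derive_line (dF (rV_cons (a, x))) => h.
    by rewrite rV_cons_lineS.
  + by move=> x /ncubeS xM; exact: F0.
  + by move=> x /ncubeS xM; exact: f0.
- rewrite -(integral21_prod_meas1 intg)/= /fubini_G.
  rewrite integral0_eq// => x _.
  apply: (@integral_derive_compact_support M (fun a => F (rV_cons (a, x)))).
  + move=> a; apply: continuous_comp; [exact: continuous_rV_consl|exact: cf].
  + move=> a; apply: is_derive_line (dF (rV_cons (a, x))) => h.
    by rewrite /= [h *: 1]mulr1 rV_cons_line0.
  + by move=> a /ncube0 xM; exact: F0.
  + by move=> a /ncube0 xM; exact: f0.
Qed.

End integral_partial.

(** * The heat kernel *)

Section heat_kernel_facts.
Context {R : realType}.
Implicit Types t : R.

Lemma sqnorm_ge0 n (x : 'rV[R]_n) : 0 <= sqnorm x.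
Proof. by apply: sumr_ge0 => i _; exact: sqr_ge0. Qed.

Lemma sqnormN n (x : 'rV[R]_n) : sqnorm (- x) = sqnorm x.
Proof. by apply: eq_bigr => i _; rewrite mxE sqrrN. Qed.

Lemma sqr_coord_le_sqnorm n (x : 'rV[R]_n) i : x ord0 i ^+ 2 <= sqnorm x.
Proof.
rewrite /sqnorm (bigD1 i)//= lerDl; apply: sumr_ge0 => j _; exact: sqr_ge0.
Qed.

Lemma sqnorm_line n (x : 'rV[R]_n) i (h : R) :
  sqnorm (h *: delta_mx ord0 i + x) = sqnorm x + (2 * h * x ord0 i + h ^+ 2).
Proof.
rewrite /sqnorm (bigD1 i)//= [in RHS](bigD1 i)//= !mxE !eqxx mulr1.
rewrite [in RHS]addrAC; congr (_ + _); first by ring.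
by apply: eq_bigr => j ji; rewrite !mxE (negbTE ji) andbF mulr0 add0r.
Qed.

Lemma continuous_sqnorm n : continuous (@sqnorm R n).
Proof.
rewrite /sqnorm; apply: continuous_big => [|i _ x]; first exact: add_continuous.
apply: (@continuous_comp _ _ _ (fun x : 'rV[R]_n => x ord0 i) (fun u => u ^+ 2)).
  exact: coord_continuous.
exact: exprn_continuous.
Qed.

Lemma measurable_sqnorm n : measurable_fun setT (@sqnorm R n).
Proof. by apply: continuous_measurable_rV; exact: continuous_sqnorm. Qed.

Lemma heat_kernel_ge0 n t (x : 'rV[R]_n) : 0 <= heat_kernel t x.
Proof. by rewrite mulr_ge0 ?powR_ge0 ?expR_ge0. Qed.

Lemma heat_kernelN n t (x : 'rV[R]_n) : heat_kernel t (- x) = heat_kernel t x.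
Proof. by rewrite /heat_kernel sqnormN. Qed.

Lemma heat_kernel_le n t (x : 'rV[R]_n) : 0 < t ->
  heat_kernel t x <= (4 * pi * t) `^ (- (n%:R / 2)).
Proof.
move=> t0; rewrite ler_piMr ?powR_ge0// -[leRHS]expR0 ler_expR.
by rewrite mulNr oppr_le0 divr_ge0 ?sqnorm_ge0// mulr_ge0// ltW.
Qed.

(** In each coordinate the kernel is the normal density with mean [y_i] and variance [2t], whose
    integral is known to be 1. *)
Lemma heat_kernel_prod n t (y z : 'rV[R]_n) : 0 < t ->
  heat_kernel t (y - z) =
  \prod_(i < n) normal_pdf (y ord0 i) (Num.sqrt (2 * t)) (z ord0 i).
Proof.
move=> t0.
have s0 : Num.sqrt (2 * t) != 0 by rewrite gt_eqF// sqrtr_gt0 mulr_gt0.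
under eq_bigr do rewrite normal_pdfE//.
rewrite big_split/=; congr (_ * _).
  rewrite prodr_const card_ord /normal_peak sqr_sqrtr ?mulr_ge0 ?ltW//.
  rewrite -powR12_sqrt ?mulrn_wge0 ?mulr_ge0 ?pi_ge0 ?ltW//.
  rewrite powRN [n%:R / 2]mulrC powRrM powR_mulrn ?powR_ge0// exprVn.
  by congr ((_ `^ _ ^+ _)^-1); rewrite -mulr_natr; ring.
rewrite -expR_sum; congr expR.
rewrite -mulr_suml sumrN /sqnorm -mulr_natr sqr_sqrtr ?mulr_ge0 ?ltW//.
congr (- _ / _); last by ring.
by apply: eq_bigr => i _; rewrite !mxE -sqrrN opprB.
Qed.

Lemma integral_heat_kernel n t (y : 'rV[R]_n) : 0 < t ->
  (\int[lebesgue_rV n]_z (heat_kernel t (y - z))%:E = 1)%E.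
Proof.
move=> t0; under eq_integral do rewrite heat_kernel_prod//.
rewrite (@ge0_integral_rV_prod _ n (fun i => normal_pdf (y ord0 i) (Num.sqrt (2 * t)))).
- by rewrite big1// => i _; exact: integral_normal_pdf.
- by move=> i; exact: measurable_normal_pdf.
- by move=> i x; exact: normal_pdf_ge0.
Qed.

Lemma integral_heat_kernelr n t (z : 'rV[R]_n) : 0 < t ->
  (\int[lebesgue_rV n]_y (heat_kernel t (y - z))%:E = 1)%E.
Proof.
move=> t0; rewrite -(integral_heat_kernel z t0); apply: eq_integral => y _.
by rewrite -heat_kernelN opprB.
Qed.

(** Inversion is discontinuous at 0, so it is rewritten as [x] times the power [-1] of its square.
    Both sides are 0 at [x = 0], by the convention for the inverse of 0 on the left and the factor
    [x] on the right. *)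
Lemma measurable_invr : measurable_fun setT (@GRing.inv R).
Proof.
rewrite (_ : @GRing.inv R = fun x => x * (x ^+ 2) `^ (-1)); last first.
  apply/funext => x; rewrite powR_inv1 ?sqr_ge0//.
  have [->|x0] := eqVneq x 0; first by rewrite invr0 mul0r.
  by field.
apply: measurable_funM => //; apply: (measurableT_comp (measurable_powR _)).
exact: measurable_funX.
Qed.

Lemma measurable_heat_kernel d (X : measurableType d) n (g : X -> R) (f : X -> 'rV[R]_n) :
  measurable_fun setT g -> measurable_fun setT f ->
  measurable_fun setT (fun p => heat_kernel (g p) (f p)).
Proof.
move=> mg mf; rewrite /heat_kernel; apply: measurable_funM.
  apply: (measurableT_comp (measurable_powR _)).
  by apply: measurable_funM.
apply: measurableT_comp => //; apply: measurable_funM.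
  by apply: measurableT_comp => //; apply: (measurableT_comp (@measurable_sqnorm n)).
by apply: (measurableT_comp measurable_invr); apply: measurable_funM.
Qed.

Lemma measurable_subrV d (X : measurableType d) n (f g : X -> 'rV[R]_n) :
  measurable_fun setT f -> measurable_fun setT g ->
  measurable_fun setT (fun p => f p - g p).
Proof.
move=> mf mg; apply: measurable_fun_rVP => i.
rewrite (_ : (fun x => _) = (fun x => f x ord0 i - g x ord0 i)); last first.
  by apply/funext => x; rewrite !mxE.
apply: measurable_funB.
  exact: (measurableT_comp (measurable_coord_rV (T := R) i) mf).
exact: (measurableT_comp (measurable_coord_rV (T := R) i) mg).
Qed.

Lemma is_derive1_comp (f g : R -> R) (x df dg : R) :
  is_derive x (1 : R) f df -> is_derive (f x) (1 : R) g dg ->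
  is_derive x (1 : R) (g \o f) (dg * df).
Proof.
move=> [fx <-] [gx <-]; split; last by rewrite -!derive1E derive1_comp.
apply/derivable1_diffP; apply: differentiable_comp; exact/derivable1_diffP.
Qed.

Lemma is_derive1V (f : R -> R) (x df : R) : f x != 0 ->
  is_derive x (1 : R) f df ->
  is_derive x (1 : R) (fun y => (f y)^-1) (- (f x) ^- 2 * df).
Proof.
by move=> fx0 [fx <-]; split; [exact: derivableV|rewrite deriveV].
Qed.

(** Along a coordinate line only one square changes, so the kernel is a constant times a
    one-variable exponential. Its partial derivatives thereby become one-variable derivatives at
    [h = 0]. *)
Lemma heat_kernel_line n t (x : 'rV[R]_n) i (h : R) :
  heat_kernel t (h *: delta_mx ord0 i + x) =
  heat_kernel t x * expR (- (2 * h * x ord0 i + h ^+ 2) / (4 * t)).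
Proof.
rewrite /heat_kernel sqnorm_line -[RHS]mulrA -expRD; congr (_ * expR _).
by rewrite !mulNr mulrDl opprD.
Qed.

Lemma is_derive_heat_kernel n t (x : 'rV[R]_n) i : 0 < t ->
  is_derive x (delta_mx ord0 i : 'rV[R]_n) (heat_kernel t)
    (- (x ord0 i / (2 * t)) * heat_kernel t x).
Proof.
move=> t0.
have H : is_derive (0 : R) (1 : R)
    (fun h : R => heat_kernel t x * expR (- (2 * h * x ord0 i + h ^+ 2) / (4 * t)))
    (- (x ord0 i / (2 * t)) * heat_kernel t x).
  have H1 : is_derive (0 : R) (1 : R)
      (fun h : R => - (2 * h * x ord0 i + h ^+ 2) / (4 * t)) (- (x ord0 i / (2 * t))).
    apply: is_derive_eq.
    rewrite /GRing.scale/= !(mulr0, mul0r, addr0, add0r, oppr0, expr0n)/=.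
    by field; rewrite gt_eqF.
  have H2 := is_derive1_comp H1 (is_derive_expR _).
  apply: is_derive_eq.
  rewrite /GRing.scale/= !(mulr0, mul0r, addr0, add0r, oppr0, expr0n)/= expR0.
  by rewrite mul1r mulrC.
apply: is_derive_line H => h /=.
by rewrite addr0 [h *: 1]mulr1 heat_kernel_line.
Qed.

Lemma is_derive_coord n (x : 'rV[R]_n) i :
  is_derive x (delta_mx ord0 i : 'rV[R]_n) (fun x => x ord0 i) (1 : R).
Proof.
have H : is_derive (0 : R) (1 : R) (fun h : R => h + x ord0 i) (1 : R).
  by apply: is_derive_eq; rewrite addr0.
apply: is_derive_line H => h /=.
by rewrite !mxE !eqxx /= addr0 [h *: 1]mulr1 mulr1.
Qed.

Lemma is_derive_shift n (f : 'rV[R]_n -> R) (x z v : 'rV[R]_n) d :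
  is_derive (x - z) v f d -> is_derive x v (fun y => f (y - z)) d.
Proof. by move=> H; apply: is_derive_line H => h /=; rewrite addrA. Qed.

(** The exponent contributes the term with [sqnorm x], and the power [t^(-n/2)] contributes the term
    with [n]. *)
Lemma is_derive_heat_kernel_time n t (x : 'rV[R]_n) : 0 < t ->
  is_derive t (1 : R) (fun s : R => heat_kernel s x)
    (heat_kernel t x * (sqnorm x / (4 * t ^+ 2) - n%:R / (2 * t))).
Proof.
move=> t0.
have pt0 : 0 < 4 * pi * t by rewrite !mulr_gt0// pi_gt0.
rewrite /heat_kernel.
have d4 : is_derive t (1 : R) (fun s : R => (4 * s)^-1) (- (4 * t ^+ 2)^-1).
  apply: is_derive_eq.
    apply: is_derive1V; first by rewrite mulf_neq0 ?gt_eqF.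
  by rewrite /GRing.scale/=; field; rewrite gt_eqF.
have dp : is_derive t (1 : R) (fun s : R => 4 * pi * s) (4 * pi).
  by apply: is_derive_eq; rewrite /GRing.scale/=; ring.
have H1 := is_derive1_comp dp (is_derive1_powR (- (n%:R / 2)) pt0).
have H2 : is_derive t (1 : R) (fun s : R => - sqnorm x / (4 * s)) (sqnorm x / (4 * t ^+ 2)).
  by apply: is_derive_eq; rewrite /GRing.scale/=; ring.
have H3 := is_derive1_comp H2 (is_derive_expR _).
apply: (is_derive_eq (is_deriveM H1 H3)) => /=.
rewrite /GRing.scale/=.
rewrite powRB; last by apply/implyP => _; rewrite gt_eqF.
rewrite powRr1 ?ltW//; have := pi_gt0 R; move: (@pi R) => p p0; field.
by rewrite (gt_eqF t0) (gt_eqF p0).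
Qed.

(* With [v = |x|^2 / (8t)] this is [v exp(-2v) <= exp(-v)]: a kernel at time [2t]
   replaces the second moment of the Gaussian. *)
Lemma heat_kernel_moment n t (x : 'rV[R]_n) : 0 < t ->
  sqnorm x * heat_kernel t x <=
  8 * t * 2 `^ (n%:R / 2) * heat_kernel (2 * t) x.
Proof.
move=> t0.
have pt0 : 0 < 4 * pi * t by rewrite !mulr_gt0// pi_gt0.
rewrite /heat_kernel (_ : 4 * pi * (2 * t) = 2 * (4 * pi * t)); last by ring.
rewrite [(2 * _) `^ _]powRM ?(ltW pt0)//.
have A0 : 0 < 2 `^ (n%:R / 2) :> R by rewrite powR_gt0.
rewrite [2 `^ (- _)]powRN [leRHS](_ : _ = (4 * pi * t) `^ (- (n%:R / 2)) *
   (8 * t * expR (- sqnorm x / (4 * (2 * t))))); last first.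
  move: (2 `^ _) A0 => A A0; move: ((4 * pi * t) `^ _) (expR _) => b c.
  by field; rewrite gt_eqF.
rewrite mulrCA ler_wpM2l ?powR_ge0//.
pose v := sqnorm x / (8 * t).
rewrite (_ : sqnorm x = 8 * t * v); last by rewrite /v; field; rewrite gt_eqF.
rewrite -[leLHS]mulrA ler_wpM2l// ?mulr_ge0 ?(ltW t0)//.
rewrite (_ : - _ / _ = - v - v); last by field; rewrite gt_eqF.
rewrite (_ : - _ / _ = - v); last by field; rewrite gt_eqF.
rewrite expRD mulrA ler_piMl ?expR_ge0//.
rewrite expRN ler_pdivrMr ?expR_gt0// mul1r.
by rewrite (le_trans _ (expR_ge1Dx v))// lerDr.
Qed.

End heat_kernel_facts.

(** * Duality with the backward equation *)

Section green.
Context {R : realType}.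

Lemma partial_eq0 n (U : set 'rV[R]_n) (f : 'rV[R]_n -> R) i : open U ->
  (forall x, U x -> f x = 0) -> forall x, U x -> partial i f x = 0.
Proof.
move=> oU f0 x Ux; rewrite /partial.
rewrite (@near_eq_derive _ _ _ f (cst 0)) ?derive_cst//.
by near=> y; rewrite f0//; near: y; exact: oU.
Unshelve. all: by end_near. Qed.

(** Collects what the duality argument takes from a test function: pure second derivatives only, and
    a single cube outside which [phi] and these derivatives vanish. The [is_derive] form supplies
    the values of the derivatives to the product rule. *)
Variant C2_cube n (M : R) (phi : 'rV[R]_n -> R) : Prop := C2Cube of
  continuous phi &
  (forall i, continuous (partial i phi)) &
  (forall i, continuous (partial i (partial i phi))) &
  (forall i x, is_derive x (delta_mx ord0 i : 'rV[R]_n) phi (partial i phi x)) &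
  (forall i x, is_derive x (delta_mx ord0 i : 'rV[R]_n) (partial i phi)
     (partial i (partial i phi) x)) &
  (forall x, ~ rV_cube n M x -> phi x = 0) &
  (forall i x, ~ rV_cube n M x -> partial i phi x = 0) &
  (forall i x, ~ rV_cube n M x -> partial i (partial i phi) x = 0).

Lemma notin_tsupport0 n (phi : 'rV[R]_n -> R) x : ~ tsupport phi x -> phi x = 0.
Proof. by move=> sx; apply: contrapT => /eqP x0; apply: sx; exact: subset_closure. Qed.

(** Vanishing passes to derivatives on open sets only. It is therefore propagated on the complement
    of [tsupport phi], since the complement of [B] need not be open. *)
Lemma test_function_laplacian0 n (B : set 'rV[R]_n) phi x :
  test_function B phi -> ~ B x -> laplacian phi x = 0.
Proof.
move=> [_ _ sB] Bx; rewrite /laplacian big1// => i _.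
have oS : open (~` tsupport phi) by apply: closed_openC; exact: closed_closure.
have p0 y : (~` tsupport phi) y -> phi y = 0 by exact: notin_tsupport0.
by apply: (partial_eq0 i oS (partial_eq0 i oS p0)) => /sB.
Qed.

Lemma test_function0 n (B : set 'rV[R]_n) phi x :
  test_function B phi -> ~ B x -> phi x = 0.
Proof. by move=> [_ _ sB] Bx; apply: notin_tsupport0 => /sB. Qed.

Lemma test_function_C2 n (B : set 'rV[R]_n) phi :
  test_function B phi -> exists M, C2_cube M phi.
Proof.
move=> [sphi cphi sB].
have [M M0 tM] := bounded_sub_cube (compact_bounded cphi).
exists M.
have oS : open (~` tsupport phi) by apply: closed_openC; exact: closed_closure.
have p0 x : (~` tsupport phi) x -> phi x = 0 by exact: notin_tsupport0.
have p1 i := partial_eq0 i oS p0.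
have p2 i := partial_eq0 i oS (p1 i).
have tC x : ~ rV_cube n M x -> (~` tsupport phi) x by move=> xM /tM.
split.
- by have [] := sphi [::].
- by move=> i; have [] := sphi [:: i].
- by move=> i; have [] := sphi [:: i; i].
- by move=> i x; apply: derivableP; have [_] := sphi [::].
- by move=> i x; apply: derivableP; have [_] := sphi [:: i].
- by move=> x /tC; exact: p0.
- by move=> i x /tC; exact: p1.
- by move=> i x /tC; exact: p2.
Qed.

Lemma continuous_laplacian n M (phi : 'rV[R]_n -> R) : C2_cube M phi -> continuous (laplacian phi).
Proof.
move=> [_ _ c2 _ _ _ _ _]; rewrite /laplacian; apply: continuous_big => [|i _].
  exact: add_continuous.
exact: c2.
Qed.

Lemma laplacian_cube0 n M (phi : 'rV[R]_n -> R) : C2_cube M phi ->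
  forall x, ~ rV_cube n M x -> laplacian phi x = 0.
Proof. by move=> [_ _ _ _ _ _ _ p2] x xM; rewrite /laplacian big1// => i _; exact: p2. Qed.

(* [Delta K = d/ds K = heat_factor * K] for the heat kernel [K] at time [s]. *)
Definition heat_factor n (s : R) (x : 'rV[R]_n) : R :=
  sqnorm x / (4 * s ^+ 2) - n%:R / (2 * s).

(* Stated for explicit lambda-terms, unlike [continuousM] and its variants, so
   that they apply by unification. *)
Lemma continuous_funM (T : topologicalType) (f g : T -> R) : continuous f -> continuous g ->
  continuous (fun x => f x * g x).
Proof. by move=> cf cg x; apply: (@continuousM _ _ f g x); [exact: cf|exact: cg]. Qed.

Lemma continuous_funB (T : topologicalType) (f g : T -> R) : continuous f -> continuous g ->
  continuous (fun x => f x - g x).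
Proof. by move=> cf cg x; apply: (@continuousB _ _ _ f g x); [exact: cf|exact: cg]. Qed.

Lemma continuous_funD (T : topologicalType) (f g : T -> R) : continuous f -> continuous g ->
  continuous (fun x => f x + g x).
Proof. by move=> cf cg x; apply: (@continuousD _ _ _ f g x); [exact: cf|exact: cg]. Qed.

Lemma continuous_funN (T : topologicalType) (f : T -> R) : continuous f ->
  continuous (fun x => - f x).
Proof. by move=> cf x; apply: (@continuousN _ _ _ f x); exact: cf. Qed.

Lemma continuous_fun_comp (S T U : topologicalType) (g : S -> T) (f : T -> U) :
  continuous g -> continuous f -> continuous (fun x => f (g x)).
Proof. by move=> cg cf x; apply: (@continuous_comp _ _ _ g f); [exact: cg|exact: cf]. Qed.

Lemma continuous_subr_rV n (z : 'rV[R]_n) : continuous (fun y : 'rV[R]_n => y - z).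
Proof.
move=> y; apply: (@continuousB _ _ _ id (cst z)); last exact: cst_continuous.
exact: cvg_id.
Qed.

Lemma continuous_heat_kernel_shift n (t : R) (z : 'rV[R]_n) :
  continuous (fun y : 'rV[R]_n => heat_kernel t (y - z) : R).
Proof.
apply: continuous_funM; first exact: cst_continuous.
apply: continuous_fun_comp; last exact: continuous_expR.
apply: continuous_funM; last exact: cst_continuous.
apply: continuous_funN; apply: continuous_fun_comp; [exact: continuous_subr_rV|exact: continuous_sqnorm].
Qed.

Lemma heat_kernel_green_integrable n M (phi : 'rV[R]_n -> R) (t : R) (z : 'rV[R]_n) :
  C2_cube M phi ->
  (lebesgue_rV n).-integrable setT (fun y =>
     (heat_kernel t (y - z) * (heat_factor t (y - z) * phi y - laplacian phi y))%:E).
Proof.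
move=> C2; have [c0 s0] : continuous phi /\ forall x, ~ rV_cube n M x -> phi x = 0 by case: C2.
apply: (@continuous_cube_integrable _ n M (fun y => heat_kernel t (y - z) *
  (heat_factor t (y - z) * phi y - laplacian phi y))).
- apply: continuous_funM; first exact: continuous_heat_kernel_shift.
  apply: continuous_funB; last exact: continuous_laplacian C2.
  apply: continuous_funM => //; apply: continuous_funB; last exact: cst_continuous.
  apply: continuous_funM; last exact: cst_continuous.
  by apply: continuous_fun_comp; [exact: continuous_subr_rV|exact: continuous_sqnorm].
- by move=> y yM; rewrite s0// (laplacian_cube0 C2)// mulr0 subr0 mulr0.
Qed.

(** This is Green's second identity for the kernel and [phi]. It is proved coordinate by coordinate:
    each summand is the derivative of a compactly supported flux, hence has integral 0. *)
Lemma heat_kernel_green n M (phi : 'rV[R]_n -> R) (t : R) (z : 'rV[R]_n) : C2_cube M phi -> 0 < t ->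
  (\int[lebesgue_rV n]_y
     (heat_kernel t (y - z) * (heat_factor t (y - z) * phi y - laplacian phi y))%:E = 0)%E.
Proof.
move=> [c0 c1 c2 d1 d2 s0 s1 s2] t0.
pose k (y : 'rV[R]_n) : R := heat_kernel t (y - z).
(* The [i]-th part of the integrand, with [partial_i^2 K] computed. Summing [1 / (2t)] over [i]
   produces the [n / (2t)] of [heat_factor]. *)
pose g i (y : 'rV[R]_n) : R := k y * (((y - z) ord0 i ^+ 2 / (4 * t ^+ 2) - 1 / (2 * t)) * phi y
                     - partial i (partial i phi) y).
have ck : continuous k by exact: continuous_heat_kernel_shift.
have cg i : continuous (g i).
  apply: continuous_funM; first exact: ck.
  apply: continuous_funB; last exact: c2.
  apply: continuous_funM; last exact: c0.
  apply: continuous_funB; last exact: cst_continuous.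
  apply: continuous_funM; last exact: cst_continuous.
  apply: (continuous_fun_comp (f := fun u : R => u ^+ 2)); last exact: exprn_continuous.
  apply: (continuous_fun_comp (f := fun x : 'rV[R]_n => x ord0 i)); first exact: continuous_subr_rV.
  exact: coord_continuous.
have sg i y : ~ rV_cube n M y -> g i y = 0.
  by move=> yM; rewrite /g s0// s2// mulr0 subr0 mulr0.
have ig i := continuous_cube_integrable (cg i) (sg i).
rewrite (_ : (fun y => _) = (fun y => \sum_(i < n) (g i y)%:E)%E); last first.
  apply/funext => y; rewrite sumEFin; congr (_%:E).
  rewrite -mulr_sumr sumrB -mulr_suml; congr (_ * (_ * _ - _)).
  rewrite sumrB /heat_factor /sqnorm mulr_suml sumr_const card_ord; congr (_ - _).
  by rewrite -mulrnAl.
rewrite integral_sum//= big1// => i _.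
(* The flux [(partial_i K) phi - K (partial_i phi)]: the products of first derivatives cancel when
   it is differentiated in direction [i]. *)
pose F (y : 'rV[R]_n) : R := - ((y - z) ord0 i / (2 * t)) * k y * phi y - k y * partial i phi y.
have dk y : is_derive y (delta_mx ord0 i : 'rV[R]_n) k (- ((y - z) ord0 i / (2 * t)) * k y).
  by apply: is_derive_shift; exact: is_derive_heat_kernel.
have dc y : is_derive y (delta_mx ord0 i : 'rV[R]_n) (fun y => (y - z) ord0 i) 1.
  by apply: (@is_derive_shift _ _ (fun x => x ord0 i)); exact: is_derive_coord.
apply: (@integral_partial_compact_support _ n i M F) => //.
- move=> y; have dky := dk y; have dcy := dc y; have d1y := d1 i y; have d2y := d2 i y.
  apply: is_derive_eq.
  rewrite /GRing.scale/= /g /k; field; rewrite gt_eqF//.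
- by move=> y yM; rewrite /F s0// s1// !mulr0 subr0.
- exact: sg.
Qed.

End green.

(** * The duality identity away from the initial time *)

Section time_FTC.
Context {R : realType}.

(* The backward heat operator applied to the test function [(T - s) phi(y)]:
   [- (d/ds + Delta) ((T - s) phi)]. *)
Definition dual_source n (T : R) (phi : 'rV[R]_n -> R) (y : 'rV[R]_n) (s : R) : R :=
  phi y - (T - s) * laplacian phi y.

Lemma integral_indic_mul d (X : measurableType d) (m : {measure set X -> \bar R})
    (S : set X) (f : X -> R) :
  (\int[m]_x (\1_S x * f x)%:E = \int[m]_(x in S) (f x)%:E)%E.
Proof.
rewrite [RHS]integral_mkcond; apply: eq_integral => x _.
by rewrite patchE indicE; case: ifPn => _; rewrite (mul1r, mul0r).
Qed.

Lemma measurable_heat_pairing n (z : 'rV[R]_n) (S : set R) (f : 'rV[R]_n * R -> R) :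
  measurable S -> measurable_fun setT f ->
  measurable_fun setT (fun p : 'rV[R]_n * R => \1_S p.2 * (heat_kernel p.2 (p.1 - z) * f p)).
Proof.
move=> mS mf; apply: measurable_funM.
  exact: (measurableT_comp (measurable_indic (R := R) mS) measurable_snd).
apply: measurable_funM => //; apply: measurable_heat_kernel; first exact: measurable_snd.
apply: measurable_subrV; [exact: measurable_fst|exact: measurable_cst].
Qed.

(** Tonelli with the space integral inside: at each time in [S] the kernel has mass 1. The bound is
    thus uniform for [S] reaching down to 0, although the kernel itself is unbounded there. *)
Lemma heat_pairing_bound n (z : 'rV[R]_n) (S : set R) (C : R) (f : 'rV[R]_n * R -> R) :
  measurable S -> (forall s, S s -> 0 < s) -> measurable_fun setT f ->
  (forall p, S p.2 -> `|f p| <= C) ->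
  (\int[lebesgue_rV n \x @lebesgue_measure R]_p
     `|(\1_S p.2 * (heat_kernel p.2 (p.1 - z) * f p))%:E| <= C%:E * lebesgue_measure S)%E.
Proof.
move=> mS S0 mf fC.
have mg := measurable_heat_pairing z mS mf.
have mag : measurable_fun setT (fun p : 'rV[R]_n * R =>
    `|(\1_S p.2 * (heat_kernel p.2 (p.1 - z) * f p))%:E|%E).
  by apply: measurableT_comp => //; exact/measurable_EFinP.
rewrite fubini_tonelli2// /fubini_G/=.
(* If [S] is empty, the hypothesis on [f] does not give the sign of [C]; otherwise a point of [S]
   gives [0 <= C]. *)
have [S0'|/set0P[s0 Ss0]] := eqVneq S set0.
  rewrite S0' measure0 mule0; under eq_integral do under eq_integral do
    rewrite indicE in_set0 mul0r normr0.
  by under eq_integral do rewrite integral0; rewrite integral0.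
have C0 : 0 <= C by rewrite (le_trans _ (fC (0, s0) Ss0)).
rewrite -integral_cst// -integral_indic_mul.
apply: ge0_le_integral => //.
- by move=> s _; apply: integral_ge0 => y _; rewrite lee_fin.
- by have := measurable_fun_fubini_tonelli_G (m1 := lebesgue_rV n) _ mag; apply.
- by apply/measurable_EFinP; apply: measurable_funM.
- move=> s _; move: (s : R) => {}s.
  rewrite indicE; case: (boolP (s \in S)) => [/set_mem Ss|_]; last first.
    by under eq_integral do rewrite mul0r normr0; rewrite integral0 mul0r.
  rewrite mul1r -[leRHS]mule1 -(integral_heat_kernelr z (S0 s Ss)).
  have mK : measurable_fun setT (fun y : 'rV[R]_n => heat_kernel s (y - z)).
    by apply: continuous_measurable_rV; exact: continuous_heat_kernel_shift.
  rewrite -ge0_integralZl//; last 2 first.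
  - exact/measurable_EFinP.
  - by move=> y _; rewrite lee_fin heat_kernel_ge0.
  apply: ge0_le_integral => //.
  + by have := measurable_fun_pair1 s mag; rewrite /= indicE mem_set.
  + by apply/measurable_EFinP; apply: (measurable_funM (f := cst C)).
  + move=> y _; rewrite lee_fin mul1r normrM ger0_norm ?heat_kernel_ge0// mulrC.
    by rewrite ler_wpM2r ?heat_kernel_ge0// fC.
Qed.

Lemma heat_pairing_integrable n (z : 'rV[R]_n) (S : set R) (C : R) (f : 'rV[R]_n * R -> R) :
  measurable S -> (forall s, S s -> 0 < s) -> (lebesgue_measure S < +oo)%E ->
  measurable_fun setT f -> (forall p, S p.2 -> `|f p| <= C) -> 0 <= C ->
  (lebesgue_rV n \x @lebesgue_measure R)%E.-integrable setT
    (fun p => (\1_S p.2 * (heat_kernel p.2 (p.1 - z) * f p))%:E).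
Proof.
move=> mS S0 Soo mf fC C0; apply/integrableP; split.
  by apply/measurable_EFinP; exact: measurable_heat_pairing.
apply: (le_lt_trans (heat_pairing_bound z mS S0 mf fC)).
by rewrite lte_mul_pinfty.
Qed.

Lemma measurable_dual_source n M (T : R) (phi : 'rV[R]_n -> R) : C2_cube M phi ->
  measurable_fun setT (fun p : 'rV[R]_n * R => dual_source T phi p.1 p.2).
Proof.
move=> C2; have c0 : continuous phi by case: C2.
apply: measurable_funB.
  exact: (measurableT_comp (continuous_measurable_rV c0) measurable_fst).
apply: measurable_funM; first by apply: measurable_funB => //; exact: measurable_snd.
exact: (measurableT_comp (continuous_measurable_rV (continuous_laplacian C2)) measurable_fst).
Qed.

Lemma dual_source_bounded n M (T : R) (phi : 'rV[R]_n -> R) : C2_cube M phi -> 0 < T ->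
  exists2 C, 0 <= C & forall y s, 0 < s < T -> `|dual_source T phi y s| <= C.
Proof.
move=> C2 T0.
have [c0 p0] : continuous phi /\ forall x, ~ rV_cube n M x -> phi x = 0 by case: C2.
have [C1 C10 phiC] := continuous_cube_bounded c0 p0.
have [D D0 lapD] := continuous_cube_bounded (continuous_laplacian C2) (laplacian_cube0 C2).
exists (C1 + T * D); first by rewrite addr_ge0// mulr_ge0// ltW.
move=> y s /andP[s0 sT]; rewrite (le_trans (ler_normB _ _))// lerD// normrM ler_pM//.
by rewrite ger0_norm ?subr_ge0 ?(ltW sT)// gerBl ltW.
Qed.

(** The integrand is the time derivative of [(T - s) K(s, x) c]. The weight vanishes at [T], so only
    the boundary term at [eps] survives. *)
Lemma heat_kernel_time_FTC n (eps T c : R) (x : 'rV[R]_n) : 0 < eps < T ->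
  (\int[lebesgue_measure]_(s in `[eps, T[)
     (heat_kernel s x * ((T - s) * heat_factor s x - 1) * c)%:E =
   (- ((T - eps) * (heat_kernel eps x * c)))%:E)%E.
Proof.
move=> /andP[e0 eT].
pose g (s : R) : R := (T - s) * (heat_kernel s x * c).
pose g' (s : R) : R := heat_kernel s x * ((T - s) * heat_factor s x - 1) * c.
have dg (s : R) : 0 < s -> is_derive s (1 : R) g (g' s).
  move=> s0; have dK := is_derive_heat_kernel_time x s0.
  by apply: is_derive_eq; rewrite /GRing.scale/= /g' /heat_factor; ring.
have cg (s : R) : 0 < s -> {for s, continuous g}.
  move=> s0; apply: differentiable_continuous; apply/derivable1_diffP.
  by case: (dg s s0).
have cg' (s : R) : 0 < s -> {for s, continuous g'}.
  move=> s0.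
  apply: (@continuousM _ _ (fun s => heat_kernel s x * ((T - s) * heat_factor s x - 1))
    (cst c)); last exact: cst_continuous.
  apply: (@continuousM _ _ (fun s => heat_kernel s x)
                          (fun s => (T - s) * heat_factor s x - 1)).
    apply: differentiable_continuous; apply/derivable1_diffP.
    by case: (is_derive_heat_kernel_time x s0).
  apply: (@continuousB _ _ _ (fun s => (T - s) * heat_factor s x) (cst 1)); last first.
    exact: cst_continuous.
  apply: (@continuousM _ _ (fun s => T - s) (fun s => heat_factor s x)).
    by apply: (@continuousB _ _ _ (cst T) id); [exact: cst_continuous|exact: cvg_id].
  apply: (@continuousB _ R _ (fun s : R => sqnorm x / (4 * s ^+ 2)) (fun s : R => n%:R / (2 * s))).
    apply: (@continuousM _ _ (cst (sqnorm x)) (fun s : R => (4 * s ^+ 2)^-1)).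
      exact: cst_continuous.
    apply: (@continuousV R _ (fun s : R => 4 * s ^+ 2)).
      by rewrite mulf_neq0// sqrf_eq0 gt_eqF.
    apply: (@continuousM R _ (cst 4) (fun s : R => s ^+ 2)); first exact: cst_continuous.
    exact: exprn_continuous.
  apply: (@continuousM _ _ (cst n%:R) (fun s : R => (2 * s)^-1)); first exact: cst_continuous.
  apply: (@continuousV R _ (fun s : R => 2 * s)); first by rewrite mulf_neq0// gt_eqF.
  by apply: (@continuousM _ _ (cst 2) id); [exact: cst_continuous|exact: cvg_id].
have cw : {within `[eps, T], continuous g'}.
  apply: continuous_in_subspaceT => s; rewrite inE/= in_itv/= => /andP[es _].
  by apply: cg'; rewrite (lt_le_trans e0).
(* The endpoint [T] is a null set; adding it allows the fundamental theorem on a closed interval. *)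
rewrite integral_itv_bndo_bndc; last first.
  have mg' := subspace_continuous_measurable_fun (measurable_itv _) cw.
  apply/measurable_EFinP; apply: measurable_funS mg' => //.
  by apply: subset_itvl; rewrite bnd_simp.
rewrite (@continuous_FTC2 _ g' g)//.
- by rewrite /g subrr mul0r sub0e.
- split.
  + move=> s; rewrite in_itv/= => /andP[es _].
    by case: (dg s (lt_trans e0 es)).
  + by apply: cvg_at_right_filter; exact: cg.
  + by apply: cvg_at_left_filter; apply: cg; exact: lt_trans eT.
- move=> s; rewrite in_itv/= => /andP[es _].
  by rewrite derive1E; case: (dg s (lt_trans e0 es)).
Qed.

End time_FTC.

Section duality_after_eps.
Context {R : realType}.

Lemma bounded_prod_integrable n M (S : set R) C (f : 'rV[R]_n * R -> R) :
  measurable S -> (lebesgue_measure S < +oo)%E -> measurable_fun setT f ->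
  (forall p, `|f p| <= C) -> (forall p, ~ (rV_cube n M p.1 /\ S p.2) -> f p = 0) ->
  (lebesgue_rV n \x @lebesgue_measure R)%E.-integrable setT (EFin \o f).
Proof.
move=> mS Soo mf fC f0.
have mE : measurable (rV_cube n M `*` S) by apply: measurableX => //; exact: measurable_rV_cube.
have -> : EFin \o f = (EFin \o f) \_ (rV_cube n M `*` S).
  apply/funext => p; rewrite patchE; case: ifPn => // /negP; rewrite inE => /f0 /=.
  by move=> ->.
apply/(@integrable_mkcond _ _ _ (lebesgue_rV n \x @lebesgue_measure R)%E _ (EFin \o f) mE); apply: measurable_bounded_integrable => //.
- have := product_measure1E (lebesgue_rV n) (@lebesgue_measure R)
    (@measurable_rV_cube R n M) mS.
  rewrite /= => ->; by rewrite lte_mul_pinfty ?ge0_fin_numE ?lebesgue_rV_cube_lty.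
- exact: measurable_funTS.
- exists C; split; first exact: num_real.
  by move=> D CD x _; exact: le_trans (fC x) (ltW CD).
Qed.

Lemma heat_kernel_le_time n (eps s : R) (x : 'rV[R]_n) : 0 < eps <= s ->
  heat_kernel s x <= (4 * pi * eps) `^ (- (n%:R / 2)).
Proof.
move=> /andP[e0 es]; have s0 := lt_le_trans e0 es.
have p0 (u : R) : 0 < u -> 0 < 4 * pi * u by move=> u0; rewrite !mulr_gt0// pi_gt0.
rewrite (le_trans (heat_kernel_le x s0))// !powRN lef_pV2 ?posrE ?powR_gt0 ?p0//.
by rewrite ge0_ler_powR ?nnegrE ?(ltW (p0 _ _))// ler_wpM2l// mulr_ge0 ?pi_ge0.
Qed.

Lemma heat_factor_le n (eps s : R) (x : 'rV[R]_n) : 0 < eps <= s ->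
  `|heat_factor s x| <= sqnorm x / (4 * eps ^+ 2) + n%:R / (2 * eps).
Proof.
move=> /andP[e0 es]; have s0 := lt_le_trans e0 es.
rewrite (le_trans (ler_normB _ _))// !ger0_norm; last 2 first.
- by rewrite divr_ge0// mulr_ge0// ltW.
- by rewrite divr_ge0 ?sqnorm_ge0// mulr_ge0// sqr_ge0.
rewrite lerD// ler_wpM2l ?sqnorm_ge0// lef_pV2 ?posrE ?mulr_gt0 ?exprn_gt0// ler_pM2l//.
by rewrite lerXn2r ?nnegrE ?(ltW e0) ?(ltW s0).
Qed.

(* Integrate [d/ds ((T - s) K(s, y - z)) phi(y)] over [[eps, T[ x R^n] in both
   orders: the time integral is a boundary term at [s = eps], and the space
   integral is rewritten by Green's identity. *)
Lemma heat_duality_eps n M (phi : 'rV[R]_n -> R) (z : 'rV[R]_n) (eps T : R) :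
  C2_cube M phi -> 0 < eps < T ->
  (\int[lebesgue_rV n \x @lebesgue_measure R]_p
     (\1_(`[eps, T[%classic : set R) p.2 *
       (heat_kernel p.2 (p.1 - z) * dual_source T phi p.1 p.2))%:E =
   \int[lebesgue_rV n]_y ((T - eps) * (heat_kernel eps (y - z) * phi y))%:E)%E.
Proof.
move=> C2 eT; have /andP[e0 ltT] := eT.
have T0 : 0 < T by exact: lt_trans ltT.
have [c0 p0] : continuous phi /\ forall x, ~ rV_cube n M x -> phi x = 0 by case: C2.
pose I : set R := `[eps, T[%classic.
have mI : measurable I by exact: measurable_itv.
have I0 s : I s -> 0 < eps <= s.
  by rewrite /I/= in_itv/= => /andP[es _]; rewrite e0.
have IT s : I s -> 0 <= T - s <= T.
  rewrite /I/= in_itv/= => /andP[es sT]; rewrite subr_ge0 (ltW sT)/= gerBl.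
  by rewrite (le_trans _ es)// ltW.
have Ioo : (lebesgue_measure I < +oo)%E.
  by rewrite lebesgue_measure_itv/=; case: ifP => _; rewrite ?ltry// -EFinB ltry.
pose h (p : 'rV[R]_n * R) := heat_kernel p.2 (p.1 - z) *
    ((T - p.2) * heat_factor p.2 (p.1 - z) - 1).
pose H (p : 'rV[R]_n * R) := \1_I p.2 * (h p * phi p.1).
have msub : measurable_fun setT (fun p : 'rV[R]_n * R => p.1 - z).
  by apply: measurable_subrV; [exact: measurable_fst|exact: measurable_cst].
have m2 : measurable_fun setT (snd : 'rV[R]_n * R -> R) by exact: measurable_snd.
have mK := measurable_heat_kernel m2 msub.
have mhf : measurable_fun setT (fun p : 'rV[R]_n * R => heat_factor p.2 (p.1 - z)).
  have minv (f : 'rV[R]_n * R -> R) : measurable_fun setT f ->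
      measurable_fun setT (fun p => (f p)^-1).
    by move=> mf; exact: (measurableT_comp measurable_invr mf).
  apply: measurable_funB; apply: measurable_funM => //.
  - exact: (measurableT_comp (@measurable_sqnorm R n) msub).
  - by apply: minv; apply: measurable_funM => //; exact: measurable_funX.
  - by apply: minv; apply: measurable_funM.
have mphi := measurableT_comp (continuous_measurable_rV c0)
  (measurable_fst : measurable_fun setT (fst : 'rV[R]_n * R -> _)).
have mH : measurable_fun setT H.
  apply: measurable_funM; first exact: (measurableT_comp (measurable_indic (R := R) mI) m2).
  apply: measurable_funM => //; apply: measurable_funM => //.
  by apply: measurable_funB => //; apply: measurable_funM => //; exact: measurable_funB.
(* [|D|] bounds [|H|] uniformly for [s >= eps]: the kernel and [heat_factor] are replaced by their
   bounds at [eps], and [T - s] by [T]. The quadratic growth is harmless because [phi] has compact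
   support. *)
pose D y := (4 * pi * eps) `^ (- (n%:R / 2)) *
   (T * (sqnorm (y - z) / (4 * eps ^+ 2) + n%:R / (2 * eps)) + 1) * phi y.
have cD : continuous D.
  apply: continuous_funM => //; apply: continuous_funM; first exact: cst_continuous.
  apply: continuous_funD; last exact: cst_continuous.
  apply: continuous_funM; first exact: cst_continuous.
  apply: continuous_funD; last exact: cst_continuous.
  apply: continuous_funM; last exact: cst_continuous.
  by apply: continuous_fun_comp; [exact: continuous_subr_rV|exact: continuous_sqnorm].
have D0 y : ~ rV_cube n M y -> D y = 0 by move=> yM; rewrite /D p0// mulr0.
have [CD CD0 DC] := continuous_cube_bounded cD D0.
have HC p : `|H p| <= CD.
  rewrite /H indicE; case: (boolP (p.2 \in I)) => [/set_mem pI|_]; last by rewrite mul0r normr0.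
  rewrite mul1r (le_trans _ (DC p.1))// /D !normrM ler_wpM2r// ler_pM//.
    rewrite !ger0_norm ?powR_ge0 ?heat_kernel_ge0//.
    exact: heat_kernel_le_time (I0 _ pI).
  have /andP[Ts0 TsT] := IT _ pI.
  rewrite (le_trans (ler_normB _ _))// normr1 [leRHS]ger0_norm; last first.
    rewrite addr_ge0// mulr_ge0 ?(ltW T0)// addr_ge0// divr_ge0 ?sqnorm_ge0//.
      by rewrite mulr_ge0// sqr_ge0.
    by rewrite mulr_ge0// ltW.
  rewrite lerD2r normrM ger0_norm//; apply: ler_pM => //.
  exact: heat_factor_le (I0 _ pI).
have iH : (lebesgue_rV n \x @lebesgue_measure R)%E.-integrable setT (EFin \o H).
  apply: (bounded_prod_integrable (M := M) mI Ioo mH HC) => p pMI; rewrite /H.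
  have [pI|pI] := pselect (I p.2); last by rewrite indicE memNset// mul0r.
  by rewrite p0 ?mulr0// => pM; exact: pMI.
have iP : (lebesgue_rV n \x @lebesgue_measure R)%E.-integrable setT
    (fun p => (\1_I p.2 * (heat_kernel p.2 (p.1 - z) * dual_source T phi p.1 p.2))%:E).
  have [C C0 psiC] := dual_source_bounded C2 T0.
  apply: (@heat_pairing_integrable _ n z I C (fun p => dual_source T phi p.1 p.2)) => //.
  - by move=> s /I0/andP[_]; exact: lt_le_trans.
  - exact: measurable_dual_source C2.
  - move=> p pI; apply: psiC; move: pI; rewrite /I/= in_itv/= => /andP[es ->].
    by rewrite (lt_le_trans e0 es).
have intH1 : (\int[lebesgue_rV n \x @lebesgue_measure R]_p (H p)%:E =
    - \int[lebesgue_rV n]_y ((T - eps) * (heat_kernel eps (y - z) * phi y))%:E)%E.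
  rewrite -(integral12_prod_meas1 iH) /fubini_F/=.
  rewrite -integralN; last first.
    apply: integrable_add_def => //; apply: (@continuous_cube_integrable _ n M (fun y => (T - eps) * (heat_kernel eps (y - z) * phi y))).
      apply: continuous_funM; first exact: cst_continuous.
      by apply: continuous_funM => //; exact: continuous_heat_kernel_shift.
    by move=> y yM; rewrite p0// !mulr0.
  apply: eq_integral => y _.
  transitivity (\int[lebesgue_measure]_(s in I) (h (y, s) * phi y)%:E)%E.
    exact: integral_indic_mul.
  rewrite -EFinN; exact: (heat_kernel_time_FTC (phi y) (y - z) eT).
have intH2 : (\int[lebesgue_rV n \x @lebesgue_measure R]_p (H p)%:E =
    - \int[lebesgue_rV n \x @lebesgue_measure R]_p
     (\1_I p.2 * (heat_kernel p.2 (p.1 - z) * dual_source T phi p.1 p.2))%:E)%E.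
  rewrite -integralN; last by apply: integrable_add_def.
  rewrite -(integral21_prod_meas1 iH) -(integral21_prod_meas1 (integrableN iP)) /fubini_G/=.
  apply: eq_integral => s _; move: (s : R) => {}s.
  have [sI|sI] := boolP (s \in I); last first.
    by rewrite !integral0_eq// => y _; rewrite /H/= indicE (negbTE sI) mul0r ?oppr0 ?oppe0.
  have iPs : (lebesgue_rV n).-integrable setT
      (fun y => (heat_kernel s (y - z) * dual_source T phi y s)%:E).
    apply: (@continuous_cube_integrable _ n M (fun y => heat_kernel s (y - z) * dual_source T phi y s)).
      apply: continuous_funM; first exact: continuous_heat_kernel_shift.
      apply: continuous_funB => //; apply: continuous_funM; first exact: cst_continuous.
      exact: continuous_laplacian C2.
    by move=> y yM; rewrite /dual_source p0// (laplacian_cube0 C2)// mulr0 subr0 mulr0.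
  have iG := heat_kernel_green_integrable s z C2.
  (* At fixed [s], [H] is minus the dual pairing integrand plus [T - s] times the Green integrand,
     and the latter integrates to 0. *)
  transitivity (\int[lebesgue_rV n]_y
    (- (heat_kernel s (y - z) * dual_source T phi y s)%:E +
     (T - s)%:E * (heat_kernel s (y - z) *
        (heat_factor s (y - z) * phi y - laplacian phi y))%:E))%E.
    apply: eq_integral => y _; rewrite /H indicE sI mul1r -EFinM -EFinN -EFinD.
    by congr (_%:E); rewrite /h /dual_source /=; ring.
  rewrite integralD//; last 2 first.
  - exact: integrableN.
  - exact: integrableZl.
  rewrite integralZl// (heat_kernel_green _ C2) ?mule0 ?adde0; last first.
    by have /I0/andP[_] := set_mem sI; exact: lt_le_trans.
  by apply: eq_integral => y _; rewrite indicE sI mul1r.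
by apply: oppe_inj; rewrite -intH1 -intH2.
Qed.

End duality_after_eps.

(** * Passage to the initial time *)

Section duality.
Context {R : realType}.

Lemma heat_kernel_integrable n (t : R) (z : 'rV[R]_n) : 0 < t ->
  (lebesgue_rV n).-integrable setT (fun y => (heat_kernel t (y - z))%:E).
Proof.
move=> t0; apply/integrableP; split.
  apply/measurable_EFinP; apply: continuous_measurable_rV; exact: continuous_heat_kernel_shift.
under eq_integral do rewrite gee0_abs ?lee_fin ?heat_kernel_ge0//.
by rewrite integral_heat_kernelr// ltry.
Qed.

(** Continuity gives [d] near [z]; away from [z] the global bound [2C] is at most
    [2C |y - z|^2 / r^2]. This form replaces a tail estimate for the kernel by its second moment. *)
Lemma continuous_quadratic_bound n M (phi : 'rV[R]_n -> R) (z : 'rV[R]_n) (d : R) :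
  continuous phi -> (forall x, ~ rV_cube n M x -> phi x = 0) -> 0 < d ->
  exists2 A, 0 <= A & forall y, `|phi y - phi z| <= d + A * sqnorm (y - z).
Proof.
move=> cphi phi0 d0; have [C C0 phiC] := continuous_cube_bounded cphi phi0.
have /cvgrPdist_lt/(_ d d0) := cphi z; rewrite -nbhs_ballE => -[r /= r0 zr].
exists (2 * C / r ^+ 2); first by rewrite divr_ge0 ?sqr_ge0// mulr_ge0.
move=> y; have [/zr/= yz|yz] := pselect (ball z r y).
  rewrite distrC (le_trans (ltW yz))// lerDl mulr_ge0 ?sqnorm_ge0//.
  by rewrite divr_ge0 ?sqr_ge0// mulr_ge0.
(* Balls are those of the sup norm, so leaving one means that a single coordinate differs by at
   least [r]; this already makes the Euclidean square at least [r^2]. *)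
have [i ri] : exists i, r <= `|z ord0 i - y ord0 i|.
  apply: contrapT => /forallNP H; apply: yz; split => // i j; rewrite !ord1.
  by rewrite /ball/= ltNge; apply/negP; exact: H.
rewrite (@le_trans _ _ (2 * C))//.
  by rewrite (le_trans (ler_normB _ _))// mulrDl !mul1r lerD.
rewrite (le_trans _ (ler_wpDl (ltW d0) (lexx _)))// -mulrA ler_peMr ?mulr_ge0//.
rewrite ler_pdivlMl ?exprn_gt0// mulr1 (le_trans _ (sqr_coord_le_sqnorm _ i))//.
rewrite !mxE -[leRHS]real_normK ?num_real// distrC.
by rewrite lerXn2r ?nnegrE ?(ltW r0).
Qed.

Lemma heat_kernel_approx_id n M (phi : 'rV[R]_n -> R) (z : 'rV[R]_n) (d : R) :
  continuous phi -> (forall x, ~ rV_cube n M x -> phi x = 0) -> 0 < d ->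
  exists2 eta, 0 < eta & forall eps, 0 < eps < eta ->
    `|\int[lebesgue_rV n]_y (heat_kernel eps (y - z) * phi y) - phi z| <= d.
Proof.
move=> cphi phi0 d0.
have [A A0 phiA] := continuous_quadratic_bound z cphi phi0 (divr_gt0 d0 (@ltr0n R 2)).
pose c : R := A * (8 * 2 `^ (n%:R / 2)).
have c0 : 0 <= c by rewrite !mulr_ge0// powR_ge0.
(* By [heat_kernel_moment] the quadratic term costs at most [c * eps] times a kernel of mass 1, and
   this choice keeps it below [d / 2]. The [+ 1] makes the denominator positive. *)
exists (d / 2 / (c + 1)); first by rewrite !divr_gt0// ltr_wpDl.
move=> eps /andP[e0 eeta].
have iK := heat_kernel_integrable z e0.
have iKphi : (lebesgue_rV n).-integrable setT (EFin \o fun y => heat_kernel eps (y - z) * phi y).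
  apply: (@continuous_cube_integrable _ n M).
    by apply: continuous_funM => //; exact: continuous_heat_kernel_shift.
  by move=> y yM; rewrite phi0// mulr0.
have iKz : (lebesgue_rV n).-integrable setT (EFin \o fun y => heat_kernel eps (y - z) * phi z).
  exact: (integrableZr measurableT (phi z) iK).
have -> : phi z = \int[lebesgue_rV n]_y (heat_kernel eps (y - z) * phi z).
  by rewrite RintegralZr// /Rintegral integral_heat_kernelr//= mul1r.
rewrite -RintegralB// -lee_fin.
have -> : d = d / 2 + d / 2 by lra.
have iB : (lebesgue_rV n).-integrable setT (EFin \o fun y =>
    heat_kernel eps (y - z) * phi y - heat_kernel eps (y - z) * phi z).
  exact: (integrableB measurableT iKphi iKz).
rewrite EFin_normr_Rintegral//.
apply: (le_trans (le_abse_integral _ measurableT (measurable_int _ iB))) => /=.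
have mK t : measurable_fun setT (fun y : 'rV[R]_n => (heat_kernel t (y - z))%:E).
  apply/measurable_EFinP; apply: continuous_measurable_rV; exact: continuous_heat_kernel_shift.
(* Since both kernels have mass 1, the constant is written as the integral of the majorant, and a
   pointwise comparison remains. *)
have -> : ((d / 2 + d / 2)%:E = \int[lebesgue_rV n]_y ((d / 2)%:E * (heat_kernel eps (y - z))%:E
     + (d / 2)%:E * (heat_kernel (2 * eps) (y - z))%:E))%E.
  rewrite ge0_integralD//.
  - rewrite !ge0_integralZl// ?lee_fin ?divr_ge0 ?(ltW d0)//.
      by rewrite !integral_heat_kernelr ?mulr_gt0// !mule1.
    by move=> y _; rewrite lee_fin heat_kernel_ge0.
  by move=> y _; rewrite lee_fin heat_kernel_ge0.
  - by move=> y _; rewrite mule_ge0// lee_fin ?heat_kernel_ge0// divr_ge0// ltW.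
  - by apply: measurable_funeM; exact: mK.
  - by move=> y _; rewrite mule_ge0// lee_fin ?heat_kernel_ge0// divr_ge0// ltW.
  - by apply: measurable_funeM; exact: mK.
apply: ge0_le_integral => //.
- by apply/measurable_EFinP; apply: measurableT_comp => //; apply/measurable_EFinP; exact: measurable_int iB.
- by apply: emeasurable_funD; apply: measurable_funeM; exact: mK.
- move=> y _; rewrite lee_fin -mulrBr normrM ger0_norm ?heat_kernel_ge0//.
  rewrite (le_trans (ler_wpM2l (heat_kernel_ge0 _ _) (phiA y)))// mulrDr mulrC lerD2l.
  rewrite mulrCA [X in A * X]mulrC.
  rewrite (le_trans (ler_wpM2l A0 (heat_kernel_moment _ e0)))// mulrA.
  rewrite ler_wpM2r ?heat_kernel_ge0//.
  have : eps * (c + 1) <= d / 2 by rewrite -ler_pdivlMr ?ltW// ltr_wpDl.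
  apply: le_trans; rewrite mulrDr mulr1 (le_trans _ (ler_wpDr (ltW e0) (lexx _)))//.
  by rewrite le_eqVlt; apply/orP; left; apply/eqP; rewrite /c; ring.
Qed.

(** The limit [eps -> 0] of [heat_duality_eps]: the slab []0, eps[] costs at most [C * eps], and the
    boundary term tends to [T * phi z] by [heat_kernel_approx_id]. *)
Lemma heat_duality n M (phi : 'rV[R]_n -> R) (z : 'rV[R]_n) (T : R) :
  C2_cube M phi -> 0 < T ->
  \int[(lebesgue_rV n \x @lebesgue_measure R)%E]_p
     (\1_(`]0, T[%classic : set R) p.2 *
       (heat_kernel p.2 (p.1 - z) * dual_source T phi p.1 p.2)) = T * phi z.
Proof.
move=> C2 T0.
have [c0 p0] : continuous phi /\ forall x, ~ rV_cube n M x -> phi x = 0 by case: C2.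
have [C C0 psiC] := dual_source_bounded C2 T0.
have mpsi := measurable_dual_source T C2.
pose P (S : set R) (p : 'rV[R]_n * R) : R :=
  \1_S p.2 * (heat_kernel p.2 (p.1 - z) * dual_source T phi p.1 p.2).
pose m : measure _ R := (lebesgue_rV n \x @lebesgue_measure R)%E.
have PS (S : set R) : measurable S -> S `<=` `]0, T[%classic ->
    (lebesgue_measure S < +oo)%E /\ m.-integrable setT (EFin \o P S) /\
    `|\int[m]_p P S p| <= C * fine (lebesgue_measure S).
  move=> mS S0T.
  have S0 s : S s -> 0 < s by move=> /S0T/=; rewrite in_itv/= => /andP[].
  have Soo : (lebesgue_measure S < +oo)%E.
    have E : (lebesgue_measure (`]0%R, T[%classic : set R) < +oo)%E.
      by rewrite lebesgue_measure_itv/=; case: ifP => _; rewrite ?ltry// -EFinB ltry.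
    by apply: le_lt_trans E; apply: le_measure; rewrite ?inE.
  have psiCS p : S p.2 -> `|dual_source T phi p.1 p.2| <= C.
    by move=> /S0T/=; rewrite in_itv/= => ?; exact: psiC.
  have iP := @heat_pairing_integrable _ n z S C _ mS S0 Soo mpsi psiCS C0.
  split => //; split => //.
  rewrite -lee_fin EFin_normr_Rintegral// EFinM fineK ?ge0_fin_numE//.
  apply: le_trans (heat_pairing_bound z mS S0 mpsi psiCS).
  by apply: le_abse_integral => //; exact: measurable_int iP.
apply/eqP; rewrite -subr_eq0 -normr_le0; apply/ler_addgt0Pr => e e_gt0; rewrite add0r.
pose d := e / (2 * T).
have d0 : 0 < d by rewrite divr_gt0// mulr_gt0.
have [eta eta0 Heta] := heat_kernel_approx_id z c0 p0 d0.
pose C1 := `|phi z| + d.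
have C10 : 0 <= C1 by rewrite addr_ge0// ltW.
have CC1 : 0 < C + C1 + 1 by rewrite ltr_wpDl// addr_ge0.
(* The three bounds serve, in order, the approximate identity, the condition [eps < T], and the
   absorption of the terms proportional to [eps] into [e / 2]. *)
pose eps := Num.min (Num.min (eta / 2) (T / 2)) (e / (2 * (C + C1 + 1))).
have eps0 : 0 < eps by rewrite !lt_min !divr_gt0// mulr_gt0.
have eps_eta : eps < eta.
  rewrite (@le_lt_trans _ _ (eta / 2))//; last by lra.
  by rewrite !ge_min lexx.
have epsT : eps < T.
  rewrite (@le_lt_trans _ _ (T / 2))//; last by lra.
  by rewrite !ge_min lexx orbT.
have epsC : eps * (C + C1 + 1) <= e / 2.
  rewrite -ler_pdivlMr// (@le_trans _ _ (e / (2 * (C + C1 + 1))))//.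
    by rewrite ge_min lexx orbT.
  by rewrite invfM mulrA.
have {}Heta : `|\int[lebesgue_rV n]_y (heat_kernel eps (y - z) * phi y) - phi z| <= d.
  by apply: Heta; rewrite eps0.
move: Heta; set J := \int[lebesgue_rV n]_y _ => HJ.
have eT : 0 < eps < T by rewrite eps0.
have [||_ [i1 I1]] := PS `]0, eps[%classic; first exact: measurable_itv.
  by apply: subset_itvl; rewrite bnd_simp ltW.
have [||_ [i2 _]] := PS `[eps, T[%classic; first exact: measurable_itv.
  by apply: subset_itvr; rewrite bnd_simp.
have I2 : \int[m]_p P `[eps, T[%classic p = (T - eps) * J.
  rewrite /Rintegral (heat_duality_eps z C2 eT) -RintegralZl//.
  apply: (@continuous_cube_integrable _ n M).
    by apply: continuous_funM => //; exact: continuous_heat_kernel_shift.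
  by move=> y yM; rewrite p0// mulr0.
have -> : \int[m]_p P `]0, T[%classic p = \int[m]_p P `]0, eps[%classic p + \int[m]_p P `[eps, T[%classic p.
  rewrite -RintegralD//; apply: eq_Rintegral => p _; rewrite /P -mulrDl; congr (_ * _).
  rewrite !indicE !mem_setE !in_itv/=; case: (ltP 0 p.2) => p20 /=; last first.
    rewrite (_ : eps <= p.2 = false) ?addr0//; apply/negbTE; rewrite -ltNge.
    exact: le_lt_trans eps0.
  case: (ltP p.2 eps) => pe /=; rewrite ?addr0 ?add0r//.
  by rewrite (lt_trans pe epsT).
rewrite I2.
have HI1 : `|\int[m]_p P `]0, eps[%classic p| <= C * eps.
  apply: le_trans I1 _; rewrite lebesgue_measure_itv/= lte_fin eps0/= subr0.
  by [].
have HJ1 : `|J| <= C1.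
  by rewrite -[J](subrK (phi z)) (le_trans (ler_normD _ _))// addrC lerD.
(* Three errors: the slab, at most [C * eps]; the approximation error, at most [T * d = e / 2]; and
   the missing [eps * J], at most [eps * C1]. *)
rewrite (_ : _ - _ = \int[m]_p P `]0, eps[%classic p + (T * (J - phi z) - eps * J)); last by ring.
rewrite (le_trans (ler_normD _ _))//.
rewrite (@le_trans _ _ (C * eps + (T * d + eps * C1)))//.
  rewrite lerD// (le_trans (ler_normB _ _))// lerD// normrM.
    by rewrite gtr0_norm// ler_pM2l.
  by rewrite gtr0_norm// ler_pM2l.
have -> : T * d = e / 2 by rewrite /d; field; rewrite gt_eqF.
have := epsC; nra.
Qed.

End duality.

(** * Pairing with the initial datum *)

Section sigma_finite_product.
Context {R : realType} (d1 d2 : measure_display) (X : measurableType d1) (Y : measurableType d2)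
  (m1 : {sigma_finite_measure set X -> \bar R})
  (m2 : {sigma_finite_measure set Y -> \bar R}).
Lemma sigma_finite_product : sigma_finite setT (m1 \x m2)%E.
Proof.
have /sigma_finiteP[F [FT ndF Foo]] := sigma_finiteT m1.
have /sigma_finiteP[G [GT ndG Goo]] := sigma_finiteT m2.
exists (fun k => F k `*` G k).
  apply/esym/seteqP; split => // -[x y] _.
  have [i _ Fi] : (\bigcup_k F k) x by rewrite -FT.
  have [j _ Gj] : (\bigcup_k G k) y by rewrite -GT.
  exists (maxn i j) => //; split.
    by move: Fi; exact/subsetPset/ndF/leq_maxl.
  by move: Gj; exact/subsetPset/ndG/leq_maxr.
move=> k; have [mF Fk] := Foo k; have [mG Gk] := Goo k.
split; first exact: measurableX.
by rewrite product_measure1E// lte_mul_pinfty ?ge0_fin_numE.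
Qed.

(* The canonical sigma-finite structure that inference finds on [m1 \x m2] is
   the one for subprobabilities, hence this explicit packing. *)
Definition sigma_finite_prod : {sigma_finite_measure set (X * Y)%type -> \bar R} :=
  HB.pack (m1 \x m2)%E (Measure_isSigmaFinite.Build _ _ _ (m1 \x m2)%E sigma_finite_product).

End sigma_finite_product.

Section pairing.
Context {R : realType}.

(** Integrability of [g] is not assumed: Tonelli handles the positive and negative parts, and [fine]
    is measurable on all extended reals. *)
Lemma measurable_fun_Rintegral d1 d2 (X : measurableType d1) (Y : measurableType d2)
    (m : {sigma_finite_measure set X -> \bar R}) (g : X * Y -> R) :
  measurable_fun setT g -> measurable_fun setT (fun y => \int[m]_x g (x, y)).
Proof.
move=> mg.
have mE : measurable_fun setT (EFin \o g) by exact/measurable_EFinP.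
apply: (@measurableT_comp _ _ _ _ _ _ (@fine R) _ (fun y => \int[m]_x (g (x, y))%:E)%E).
  exact: fine_measurable.
rewrite (_ : (fun y => _) = (fun y => \int[m]_x (EFin \o g)^\+ (x, y) -
    \int[m]_x (EFin \o g)^\- (x, y))%E); last first.
  apply/funext => y; rewrite [LHS]integralE.
  under eq_integral do rewrite (funepos_comp (EFin \o g))/=.
  by under [X in (_ - X = _)%E]eq_integral do rewrite (funeneg_comp (EFin \o g))/=.
apply: emeasurable_funB.
- by apply: (measurable_fun_fubini_tonelli_G (m1 := m)) => //; exact: measurable_funepos.
- by apply: (measurable_fun_fubini_tonelli_G (m1 := m)) => //; exact: measurable_funeneg.
Qed.

(** With [c] an upper bound of the kernel, [K^2 <= c K], hence [K |u0| <= c K + u0^2], and both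
    terms are integrable. *)
Lemma heat_semigroup_integrable n (t : R) (u0 : 'rV[R]_n -> R) (y : 'rV[R]_n) :
  u0 \in Lfun (lebesgue_rV n) 2%:E -> 0 < t ->
  (lebesgue_rV n).-integrable setT (fun z => (heat_kernel t (y - z) * u0 z)%:E).
Proof.
move=> hu0 t0; have iu2 := Lfun2_integrable_sqr hu0.
have mu0 : measurable_fun setT u0 by move: hu0; rewrite inE => /andP[/[!inE]].
pose c : R := (4 * pi * t) `^ (- (n%:R / 2)).
have iK : (lebesgue_rV n).-integrable setT (fun z => (heat_kernel t (y - z))%:E).
  rewrite (_ : (fun z => _) = (fun z => (heat_kernel t (z - y))%:E)).
    exact: heat_kernel_integrable.
  by apply/funext => z; rewrite -heat_kernelN opprB.
have mK : measurable_fun setT (fun z : 'rV[R]_n => heat_kernel t (y - z)).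
  by apply/measurable_EFinP; exact: measurable_int iK.
have iB : (lebesgue_rV n).-integrable setT
    (EFin \o (fun z => c * heat_kernel t (y - z) + u0 z ^+ 2)).
  exact: (integrableD measurableT (integrableZl measurableT c iK) iu2).
apply: le_integrable iB => //.
  by apply/measurable_EFinP; exact: measurable_funM.
move=> z _ /=; rewrite lee_fin normrM (ger0_norm (heat_kernel_ge0 _ _)).
have K0 := heat_kernel_ge0 t (y - z); have Kc := heat_kernel_le (y - z) t0.
have u2 : u0 z ^+ 2 = `|u0 z| ^+ 2 by rewrite real_normK ?num_real.
rewrite [leRHS]ger0_norm; last by rewrite addr_ge0 ?sqr_ge0// mulr_ge0// powR_ge0.
rewrite u2; move: (heat_kernel _ _) `|u0 z| (normr_ge0 (u0 z)) K0 Kc; rewrite -/c => k v v0 k0 kc.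
have ck : 0 <= k * (c - k) by rewrite mulr_ge0// subr_ge0.
have := sqr_ge0 (k - v); nra.
Qed.

Lemma Lfun2_mul_C2_integrable n M (phi u0 : 'rV[R]_n -> R) :
  u0 \in Lfun (lebesgue_rV n) 2%:E -> C2_cube M phi ->
  (lebesgue_rV n).-integrable setT (EFin \o (fun z => u0 z * phi z)).
Proof.
move=> hu0 C2; have iu2 := Lfun2_integrable_sqr hu0.
have mu0 : measurable_fun setT u0 by move: hu0; rewrite inE => /andP[/[!inE]].
have [c0 p0] : continuous phi /\ forall x, ~ rV_cube n M x -> phi x = 0 by case: C2.
have ip2 : (lebesgue_rV n).-integrable setT (EFin \o (fun z => phi z * phi z)).
  apply: (@continuous_cube_integrable _ n M); first exact: continuous_funM.
  by move=> y yM; rewrite p0// mulr0.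
apply: le_integrable (integrableD measurableT iu2 ip2) => //.
  apply/measurable_EFinP; apply: measurable_funM => //; exact: continuous_measurable_rV.
move=> z _ /=; rewrite lee_fin [leRHS]ger0_norm; last first.
  by rewrite addr_ge0 ?sqr_ge0// -expr2 sqr_ge0.
rewrite ler_norml; apply/andP; split; nra.
Qed.

(* Fubini applies because [K |u0| |psi| <= K (u0^2 + psi^2) / 2] and [K] has
   integral 1 in each space variable. *)
Lemma heat_pairing n M (phi u0 : 'rV[R]_n -> R) (T : R) :
  u0 \in Lfun (lebesgue_rV n) 2%:E -> C2_cube M phi -> 0 < T ->
  (T * \int[lebesgue_rV n]_z (u0 z * phi z) =
  \int[(lebesgue_rV n \x @lebesgue_measure R)%E]_p
     (\1_(`]0, T[%classic : set R) p.2 * (dual_source T phi p.1 p.2 * heat_semigroup p.2 u0 p.1))).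
Proof.
move=> hu0 C2 T0; have iu2 := Lfun2_integrable_sqr hu0.
have mu0 : measurable_fun setT u0 by move: hu0; rewrite inE => /andP[/[!inE]].
have [c0 p0] : continuous phi /\ forall x, ~ rV_cube n M x -> phi x = 0 by case: C2.
have [C C0 psiC] := dual_source_bounded C2 T0.
have mpsi := measurable_dual_source T C2.
pose S : set R := `]0, T[%classic.
have mS : measurable S by exact: measurable_itv.
have S0 s : S s -> 0 < s by rewrite /S/= in_itv/= => /andP[].
have Soo : (lebesgue_measure S < +oo)%E.
  by rewrite lebesgue_measure_itv/=; case: ifP => _; rewrite ?ltry// -EFinB ltry.
have psiCS (p : 'rV[R]_n * R) : S p.2 -> `|dual_source T phi p.1 p.2| <= C.
  by rewrite /S/= in_itv/= => ?; exact: psiC.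
pose m := sigma_finite_prod (lebesgue_rV n) (@lebesgue_measure R).
have msnd : measurable_fun setT (fun q : 'rV[R]_n * ('rV[R]_n * R) => q.2.2).
  exact: (measurableT_comp measurable_snd measurable_snd).
have mfst : measurable_fun setT (fun q : 'rV[R]_n * ('rV[R]_n * R) => q.2.1).
  exact: (measurableT_comp measurable_fst measurable_snd).
have mK : measurable_fun setT (fun q : 'rV[R]_n * ('rV[R]_n * R) => heat_kernel q.2.2 (q.2.1 - q.1)).
  apply: measurable_heat_kernel => //; apply: measurable_subrV => //; exact: measurable_fst.
have m1 : measurable_fun setT (fun q : 'rV[R]_n * ('rV[R]_n * R) => \1_S q.2.2 : R).
  exact: (measurableT_comp (measurable_indic (R := R) mS) msnd).
have mu0' : measurable_fun setT (fun q : 'rV[R]_n * ('rV[R]_n * R) => u0 q.1).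
  exact: (measurableT_comp mu0 measurable_fst).
have mpsi' : measurable_fun setT (fun q : 'rV[R]_n * ('rV[R]_n * R) => dual_source T phi q.2.1 q.2.2).
  exact: (measurableT_comp mpsi measurable_snd).
pose Q (q : 'rV[R]_n * ('rV[R]_n * R)) :=
  u0 q.1 * (\1_S q.2.2 * (heat_kernel q.2.2 (q.2.1 - q.1) * dual_source T phi q.2.1 q.2.2)).
(* [Q1] is integrated over [(y, s)] first, which leaves [u0^2] times the length of [S]; [Q2] over
   [z] first, which leaves [psi^2], bounded and carried by a cube times [S]. The factor 1 gives [Q1]
   the shape required by [heat_pairing_bound]. *)
pose Q1 (q : 'rV[R]_n * ('rV[R]_n * R)) :=
  u0 q.1 ^+ 2 * (\1_S q.2.2 * (heat_kernel q.2.2 (q.2.1 - q.1) * 1)).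
pose Q2 (q : 'rV[R]_n * ('rV[R]_n * R)) :=
  \1_S q.2.2 * dual_source T phi q.2.1 q.2.2 ^+ 2 * heat_kernel q.2.2 (q.2.1 - q.1).
have ind0 s : 0 <= \1_S s :> R by rewrite indicE.
have iQ1 : (lebesgue_rV n \x m)%E.-integrable setT (EFin \o Q1).
  apply/integrable12ltyP.
    apply/measurable_EFinP; apply: measurable_funM; first exact: measurable_funX.
    by apply: measurable_funM => //; apply: measurable_funM.
  have bnd (z : 'rV[R]_n) : (\int[m]_p `|(EFin \o Q1) (z, p)| <= (u0 z ^+ 2)%:E * lebesgue_measure S)%E.
    have mm := measurable_heat_pairing z mS (@measurable_cst _ _ _ _ setT (1 : R)).
    rewrite (_ : \int[m]_p _ = \int[m]_p ((u0 z ^+ 2)%R%:E *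
        `|(\1_S p.2 * (heat_kernel p.2 (p.1 - z) * 1))%R%:E|))%E; last first.
      by apply: eq_integral => p _; rewrite /Q1/= normrM EFinM ger0_norm ?sqr_ge0.
    rewrite ge0_integralZl//; last 2 first.
    - by apply/measurable_EFinP; apply: measurableT_comp.
    - by rewrite lee_fin sqr_ge0.
    apply: lee_wpmul2l; first by rewrite lee_fin sqr_ge0.
    rewrite -[leRHS]mul1e.
    by apply: (heat_pairing_bound z mS S0) => // p _; rewrite normr1.
  apply: (@le_lt_trans _ _ (\int[lebesgue_rV n]_z ((u0 z ^+ 2)%:E * lebesgue_measure S))%E).
    apply: ge0_le_integral => //.
    - by move=> z _; exact: integral_ge0.
    - have mQ1 : measurable_fun setT (fun q => `|(EFin \o Q1) q|%E).
        apply/measurable_EFinP; apply: measurableT_comp => //.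
        apply: measurable_funM; first exact: measurable_funX.
        by apply: measurable_funM => //; apply: measurable_funM.
      exact: (measurable_fun_fubini_tonelli_F (m2 := m) _ mQ1).
    - by apply: emeasurable_funM => //; exact: measurable_int iu2.
  rewrite ge0_integralZr//; last 2 first.
  - exact: measurable_int iu2.
  - by move=> z _; rewrite lee_fin sqr_ge0.
  rewrite lte_mul_pinfty// ?integral_ge0//.
  - by move=> z _; rewrite lee_fin sqr_ge0.
  - exact: integrable_fin_num iu2.
have iQ2 : (lebesgue_rV n \x m)%E.-integrable setT (EFin \o Q2).
  apply/integrable21ltyP.
    apply/measurable_EFinP; apply: measurable_funM => //.
    by apply: measurable_funM => //; exact: measurable_funX.
  have E (p : 'rV[R]_n * R) : (\int[lebesgue_rV n]_z `|(EFin \o Q2) (z, p)| =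
      (\1_S p.2 * dual_source T phi p.1 p.2 ^+ 2)%:E)%E.
    rewrite /Q2/= indicE; have [pS|pS] := boolP (p.2 \in S); last first.
      by rewrite integral0_eq ?mul0r// => z _; rewrite !mul0r normr0.
    under eq_integral do rewrite normrM (ger0_norm (heat_kernel_ge0 _ _)) EFinM.
    have ps : 0 < p.2 by have := set_mem pS; exact: S0.
    rewrite ge0_integralZl//.
    - rewrite integral_heat_kernel// mule1 ger0_norm// mulr_ge0// sqr_ge0//.
    - apply/measurable_EFinP.
      apply: (@measurable_heat_kernel _ _ _ _ (cst p.2) (fun z : 'rV[R]_n => p.1 - z)).
        exact: measurable_cst.
      by apply: measurable_subrV; [exact: measurable_cst|exact: measurable_id].
    - by move=> z _; rewrite lee_fin heat_kernel_ge0.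
  under eq_integral do rewrite E.
  have i2 : m.-integrable setT (EFin \o (fun p => \1_S p.2 * dual_source T phi p.1 p.2 ^+ 2)).
    apply: (@bounded_prod_integrable _ n M S (C ^+ 2)) => //.
    - apply: measurable_funM; last exact: measurable_funX.
      exact: (measurableT_comp (measurable_indic (R := R) mS) measurable_snd).
    - move=> p; rewrite indicE; have [pS|pS] := boolP (p.2 \in S); last by rewrite mul0r normr0 sqr_ge0.
      by rewrite mul1r normrX lerXn2r ?nnegrE// psiCS//; exact: set_mem.
    - move=> p pMS; have [pS|pS] := pselect (S p.2); last by rewrite indicE memNset// mul0r.
      rewrite /dual_source p0; last by move=> pM; exact: pMS.
      rewrite (laplacian_cube0 C2); last by move=> pM; exact: pMS.
      by rewrite mulr0 subrr expr0n mulr0.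
  exact: (integrable_lty measurableT i2).
have iQ : (lebesgue_rV n \x m)%E.-integrable setT (EFin \o Q).
  have iQ12 := integrableD measurableT iQ1 iQ2.
  apply: le_integrable iQ12 => //.
  - apply/measurable_EFinP; apply: measurable_funM => //.
    by apply: measurable_funM => //; apply: measurable_funM.
  - move=> q _ /=; rewrite lee_fin /Q /Q1 /Q2 mulr1.
    have K0 := heat_kernel_ge0 q.2.2 (q.2.1 - q.1); have I0 := ind0 q.2.2.
    have IK0 := mulr_ge0 I0 K0.
    rewrite [leRHS]ger0_norm; last first.
      apply: addr_ge0; first by apply: mulr_ge0 => //; exact: sqr_ge0.
      by apply: mulr_ge0 => //; apply: mulr_ge0 => //; exact: sqr_ge0.
    rewrite (_ : u0 _ * _ = (\1_S q.2.2 * heat_kernel q.2.2 (q.2.1 - q.1)) *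
       (u0 q.1 * dual_source T phi q.2.1 q.2.2)); last by ring.
    rewrite (_ : _ + _ = (\1_S q.2.2 * heat_kernel q.2.2 (q.2.1 - q.1)) *
       (u0 q.1 ^+ 2 + dual_source T phi q.2.1 q.2.2 ^+ 2)); last by ring.
    rewrite normrM ger0_norm//; apply: ler_wpM2l => //.
    rewrite ler_norml; apply/andP; split; nra.
have F : (\int[lebesgue_rV n]_z \int[m]_p (EFin \o Q) (z, p) =
   \int[m]_p \int[lebesgue_rV n]_z (EFin \o Q) (z, p))%E by exact: Fubini.
have iup := Lfun2_mul_C2_integrable hu0 C2.
rewrite -RintegralZl// /Rintegral; congr fine.
have E1 (z : 'rV[R]_n) : (\int[m]_p (EFin \o Q) (z, p) = (T * (u0 z * phi z))%:E)%E.
  rewrite /Q/=; under eq_integral do rewrite EFinM.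
  have iP := @heat_pairing_integrable _ n z S C _ mS S0 Soo mpsi psiCS C0.
  rewrite integralZl//.
  rewrite -[X in (_ * X)%E]fineK; last exact: integrable_fin_num iP.
  have := heat_duality z C2 T0; rewrite /Rintegral => ->.
  by rewrite -EFinM; congr (_%:E); ring.
have E2 (p : 'rV[R]_n * R) : (\int[lebesgue_rV n]_z (EFin \o Q) (z, p) =
   (\1_S p.2 * (dual_source T phi p.1 p.2 * heat_semigroup p.2 u0 p.1))%:E)%E.
  rewrite /Q/= indicE; have [pS|pS] := boolP (p.2 \in S); last first.
    by rewrite integral0_eq ?mul0r// => z _; rewrite mul0r mulr0.
  have ps : 0 < p.2 by have := set_mem pS; exact: S0.
  have iu := heat_semigroup_integrable p.1 hu0 ps.
  rewrite mul1r EFinM /heat_semigroup /Rintegral fineK; last exact: integrable_fin_num iu.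
  rewrite -integralZl//; apply: eq_integral => z _.
  by rewrite -EFinM; congr (_%:E); rewrite [true%:R * _]mul1r; ring.
under eq_integral do rewrite -E1.
by rewrite F; apply: eq_integral => p _; rewrite E2.
Qed.

End pairing.

(** * L^2 estimates and density *)

Section L2_bounds.
Context {R : realType}.
Local Open Scope ereal_scope.

Lemma Lnorm2E d (X : measurableType d) (m : {measure set X -> \bar R}) (f : X -> R) :
  'N[m]_2%:E[EFin \o f] = (\int[m]_x (f x ^+ 2)%:E) `^ 2^-1.
Proof.
rewrite unlock; congr (_ `^ _); apply: eq_integral => x _ /=.
by rewrite powR_mulrn// real_normK ?num_real.
Qed.

Lemma Lnorm2_sum d (X : measurableType d) (m : {measure set X -> \bar R})
    (I : Type) (s : seq I) (f : I -> X -> R) :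
  (forall i, measurable_fun setT (f i)) ->
  'N[m]_2%:E[EFin \o (fun x => \sum_(i <- s) f i x)%R] <=
  \sum_(i <- s) 'N[m]_2%:E[EFin \o f i].
Proof.
move=> mf; elim: s => [|i s IH].
  rewrite big_nil (_ : EFin \o _ = cst 0) ?Lnorm0//.
  by apply/funext => x /=; rewrite big_nil.
rewrite big_cons; apply: le_trans (leeD2l _ IH).
rewrite (_ : (fun x => _) = (f i \+ (fun x => \sum_(j <- s) f j x))%R); last first.
  by apply/funext => x; rewrite big_cons.
apply: minkowski_EFin => //; [exact: measurable_sum|exact: ler1n].
Qed.

(** For an infinite integral [fine] returns 0 and the bound is trivial, so measurability suffices.
    Cauchy-Schwarz can then be used before any norm is known to be finite. *)
Lemma le_abs_Rintegral d (X : measurableType d) (m : {measure set X -> \bar R}) (f : X -> R) :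
  measurable_fun setT f ->
  (`|\int[m]_x f x|%R)%:E <= \int[m]_x (`|f x|%R)%:E.
Proof.
move=> mf; apply: (@le_trans _ _ `|\int[m]_x (f x)%:E|).
  by rewrite /Rintegral; case: (\int[m]_x (f x)%:E) => //=; rewrite normr0 leey.
by apply: le_abse_integral => //; exact/measurable_EFinP.
Qed.

Lemma Cauchy_Schwarz_Rintegral d (X : measurableType d) (m : {measure set X -> \bar R})
    (f g : X -> R) : measurable_fun setT f -> measurable_fun setT g ->
  (`|\int[m]_x (f x * g x)|%R)%:E <= 'N[m]_2%:E[EFin \o f] * 'N[m]_2%:E[EFin \o g].
Proof.
move=> mf mg; apply: le_trans; first by apply: le_abs_Rintegral; exact: measurable_funM.
have := @hoelder _ _ _ m f g 2 2 mf mg (ltr0n _ 2) (ltr0n _ 2).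
rewrite Lnorm1 => /(_ _)/le_trans; apply => //.
by lra.
Qed.

(** Source of the powers of [T]: by Tonelli the norm of the product majorant factorises, and the
    time indicator contributes the square root of the length of [S]. *)
Lemma Lnorm2_prod_le d (X : measurableType d) (m : {sigma_finite_measure set X -> \bar R})
    (S : set R) (T c : R) (g : X * R -> R) (f : X -> R) :
  measurable S -> lebesgue_measure S = T%:E -> (0 <= c)%R ->
  measurable_fun setT g -> measurable_fun setT f ->
  (forall p, `|g p| <= c * (\1_S p.2 * `|f p.1|))%R ->
  'N[m \x @lebesgue_measure R]_2%:E[EFin \o g] <=
    (c * T `^ 2^-1)%:E * 'N[m]_2%:E[EFin \o f].
Proof.
move=> mS ST c0 mg mf gf.
have T0 : (0 <= T)%R by rewrite -lee_fin -ST.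
have mf2 : measurable_fun setT (fun y => (f y ^+ 2)%:E).
  by apply/measurable_EFinP; exact: measurable_funX.
have -> : (c * T `^ 2^-1)%R = ((c ^+ 2 * T) `^ 2^-1)%R.
  rewrite powRM ?sqr_ge0//; congr (_ * _)%R.
  by rewrite powR12_sqrt ?sqr_ge0// sqrtr_sqr ger0_norm.
rewrite !Lnorm2E -poweR_EFin -poweRM ?integral_ge0//; last 2 first.
- by rewrite lee_fin mulr_ge0// sqr_ge0.
- by move=> x _; rewrite lee_fin sqr_ge0.
apply: gt0_ler_poweR.
- by rewrite invr_ge0.
- by rewrite in_itv/= leey andbT integral_ge0// => x _; rewrite lee_fin sqr_ge0.
- rewrite in_itv/= leey andbT mule_ge0// ?lee_fin ?mulr_ge0 ?sqr_ge0//.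
  by apply: integral_ge0 => x _; rewrite lee_fin sqr_ge0.
have mind : measurable_fun [set: R] (\1_S : R -> R) by exact: measurable_indic.
have mindE : measurable_fun [set: R] (fun s => (\1_S s : R)%:E) by exact/measurable_EFinP.
have mh : measurable_fun setT (fun p : X * R => (c ^+ 2 * (f p.1 ^+ 2 * \1_S p.2))%:E).
  apply/measurable_EFinP; apply: measurable_funM => //; apply: measurable_funM.
    by apply: measurable_funX; exact: (measurableT_comp mf measurable_fst).
  exact: (measurableT_comp mind measurable_snd).
have h0 p : 0 <= (c ^+ 2 * (f p.1 ^+ 2 * \1_S p.2))%:E.
  by rewrite lee_fin; apply: mulr_ge0; [exact: sqr_ge0|apply: mulr_ge0 => //; exact: sqr_ge0].
apply: (@le_trans _ _ (\int[m \x @lebesgue_measure R]_p (c ^+ 2 * (f p.1 ^+ 2 * \1_S p.2))%:E)).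
  apply: ge0_le_integral => //.
  - by move=> p _; rewrite lee_fin sqr_ge0.
  - by apply/measurable_EFinP; exact: measurable_funX.
  - move=> p _; rewrite lee_fin -[leLHS]real_normK ?num_real//.
    have -> : (c ^+ 2 * (f p.1 ^+ 2 * \1_S p.2) = (c * (\1_S p.2 * `|f p.1|)) ^+ 2)%R.
      rewrite !exprMn real_normK ?num_real// indicE.
      by case: (_ \in _) => /=; rewrite ?mulr1n ?mulr0n; ring.
    by rewrite lerXn2r ?nnegrE// !mulr_ge0.
rewrite fubini_tonelli1// /fubini_F/=.
rewrite (_ : (c ^+ 2 * T)%:E = (c ^+ 2)%:E * T%:E)// -muleA.
rewrite -ST -ge0_integralZl//; last by move=> x _; rewrite lee_fin sqr_ge0.
rewrite -ge0_integralZl//; last 3 first.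
- by apply: emeasurable_funM => //; exact: measurable_cst.
- by move=> x _; rewrite mule_ge0// lee_fin sqr_ge0.
- by rewrite lee_fin sqr_ge0.
rewrite le_eqVlt; apply/orP; left; apply/eqP; apply: eq_integral => y _.
rewrite (_ : \int[_]_y0 _ = \int[@lebesgue_measure R]_s ((c ^+ 2 * f y ^+ 2)%:E * (\1_S s)%:E)); last first.
  by apply: eq_integral => s _; rewrite -EFinM mulrA.
rewrite ge0_integralZl//; last by rewrite lee_fin mulr_ge0// sqr_ge0.
by rewrite integral_indic// setIT EFinM -muleA [X in _ * X]muleC.
Qed.

Lemma measurable_heat_semigroup n (u0 : 'rV[R]_n -> R) : measurable_fun setT u0 ->
  measurable_fun setT (fun p : 'rV[R]_n * R => heat_semigroup p.2 u0 p.1).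
Proof.
move=> mu0.
apply: (measurable_fun_Rintegral (lebesgue_rV n)
  (g := fun q : 'rV[R]_n * ('rV[R]_n * R) => heat_kernel q.2.2 (q.2.1 - q.1) * u0 q.1)%R).
apply: measurable_funM; last exact: (measurableT_comp mu0 measurable_fst).
apply: measurable_heat_kernel; first exact: (measurableT_comp measurable_snd measurable_snd).
apply: measurable_subrV; last exact: measurable_fst.
exact: (measurableT_comp measurable_fst measurable_snd).
Qed.

End L2_bounds.

(** * The estimate for a single test function *)

Section test_function_bound.
Context {R : realType}.

Lemma le_poweR_half (a S : \bar R) : (0 <= a)%E -> (a ^+ 2 <= S)%E -> (a <= S `^ 2^-1)%E.
Proof.
case: a S => [r| |] [s| |]//=; rewrite ?lee_fin; last 2 first.
- by move=> _ _; rewrite ifN ?invr_neq0// leey.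
- by move=> _ _; rewrite ifN ?invr_neq0.
rewrite -expr2 => r0 rs.
have s0 : 0 <= s by rewrite (le_trans _ rs)// sqr_ge0.
by rewrite powR12_sqrt// -[leLHS]ger0_norm// -sqrtr_sqr ler_sqrt.
Qed.

Lemma heat_test_bound n (T : R) (B : set 'rV[R]_n) (C_P : R)
    (u0 phi : 'rV[R]_n -> R) (u : 'rV[R]_n -> R -> R) :
  0 < T -> open B -> 0 < C_P ->
  test_function B phi ->
  (L2norm (lebesgue_rV n) B phi <= C_P%:E * L2norm (lebesgue_rV n) B (laplacian phi))%E ->
  u0 \in Lfun (lebesgue_rV n) 2%:E ->
  (forall y t, 0 < t < T -> u y t = heat_semigroup t u0 y) ->
  (`|\int[lebesgue_rV n]_(x in B) (u0 x * phi x)|%:E <=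
    (C_P * T `^ (- 2^-1) + T `^ (2^-1))%:E
    * L2norm (lebesgue_rV n \x @lebesgue_measure R) (B `*` `]0%R, T[%classic)
        (fun yt => u yt.1 yt.2) * L2norm (lebesgue_rV n) B (laplacian phi))%E.
Proof.
move=> T0 oB CP0 tphi poinc hu0 hu.
have [M C2] := test_function_C2 tphi.
have c0 : continuous phi by case: C2.
have mB := open_measurable_rV oB.
have mu0 : measurable_fun setT u0 by move: hu0; rewrite inE => /andP[/[!inE]].
have phiB x : ~ B x -> phi x = 0 by exact: test_function0 tphi.
have lapB x : ~ B x -> laplacian phi x = 0 by exact: test_function_laplacian0 tphi.
have restr (f : 'rV[R]_n -> R) : (forall x, ~ B x -> f x = 0) -> f \_ B = f.
  move=> f0; apply/funext => x; rewrite patchE; case: ifPn => //.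
  by move=> /negP; rewrite inE => /f0 ->.
pose S : set R := `]0, T[%classic.
have mS : measurable S by exact: measurable_itv.
have ST : lebesgue_measure S = T%:E.
  by rewrite lebesgue_measure_itv/= lte_fin T0 oppr0 adde0.
set U := L2norm _ (B `*` _) _.
set L := L2norm _ B (laplacian phi) in poinc *.
have -> : \int[lebesgue_rV n]_(x in B) (u0 x * phi x) = \int[lebesgue_rV n]_x (u0 x * phi x).
  rewrite Rintegral_mkcond; congr Rintegral; apply: restr => x /phiB ->.
  by rewrite mulr0.
(* [G] vanishes off [B] times [S], because [phi] and its Laplacian vanish off [B]. The pairing
   therefore only sees the zero extension [W] of [u], whose norm is [U]. *)
pose W := (fun yt : 'rV[R]_n * R => u yt.1 yt.2) \_ (B `*` S).
pose G (p : 'rV[R]_n * R) := \1_S p.2 * dual_source T phi p.1 p.2.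
have mind : measurable_fun setT (fun p : 'rV[R]_n * R => \1_S p.2 : R).
  exact: (measurableT_comp (measurable_indic (R := R) mS) measurable_snd).
have mphi : measurable_fun setT phi by exact: continuous_measurable_rV.
have mlap : measurable_fun setT (laplacian phi).
  by apply: continuous_measurable_rV; exact: continuous_laplacian C2.
have mphi' : measurable_fun setT (fun p : 'rV[R]_n * R => phi p.1).
  exact: (measurableT_comp mphi measurable_fst).
have mlap' : measurable_fun setT (fun p : 'rV[R]_n * R => laplacian phi p.1).
  exact: (measurableT_comp mlap measurable_fst).
have mG : measurable_fun setT G.
  by apply: measurable_funM => //; exact: measurable_dual_source C2.
have mBS : measurable (B `*` S) by exact: measurableX.
have mW : measurable_fun setT W.
  (* Nothing is assumed on [u] outside []0, T[]; measurability of [W] is inherited from the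
     semigroup formula, which holds on [S]. *)
  rewrite (_ : W = (fun p => heat_semigroup p.2 u0 p.1) \_ (B `*` S)).
    apply: (iffLR (measurable_restrictT _ mBS)); apply: measurable_funTS.
    exact: measurable_heat_semigroup.
  apply/funext => p; rewrite /W !patchE; case: ifPn => // /set_mem[_].
  by rewrite /S/= in_itv/= => /hu ->.
have E : T * \int[lebesgue_rV n]_x (u0 x * phi x) =
    \int[(lebesgue_rV n \x @lebesgue_measure R)%E]_p (G p * W p).
  rewrite (heat_pairing hu0 C2 T0); apply: eq_Rintegral => p _.
  rewrite mulrA -/S -/(G p) /W patchE; case: ifPn => [/set_mem[_]|/negP].
    by rewrite /S/= in_itv/= => /hu ->.
  rewrite inE/= => BS; suff -> : G p = 0 by rewrite !mul0r.
  rewrite /G; have [pS|pS] := pselect (S p.2); last by rewrite indicE memNset// mul0r.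
  have pB : ~ B p.1 by move=> pB; apply: BS.
  by rewrite /dual_source phiB// lapB// mulr0 subrr mulr0.
have CS : ((T * `|\int[lebesgue_rV n]_x (u0 x * phi x)|)%:E <=
    'N[lebesgue_rV n \x @lebesgue_measure R]_2%:E[EFin \o G] * U)%E.
  rewrite -[X in (X * _)%:E](gtr0_norm T0) -normrM E.
  exact: Cauchy_Schwarz_Rintegral.
have NG : ('N[lebesgue_rV n \x @lebesgue_measure R]_2%:E[EFin \o G] <=
    (C_P * T `^ 2^-1 + T * T `^ 2^-1)%:E * L)%E.
  (* The two terms of the dual source are bounded separately: the Poincare inequality converts the
     norm of [phi] into [C_P * L], and [|s - T| <= T] on [S] gives the second constant. *)
  pose G1 (p : 'rV[R]_n * R) := \1_S p.2 * phi p.1.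
  pose G2 (p : 'rV[R]_n * R) := \1_S p.2 * ((p.2 - T) * laplacian phi p.1).
  have mG1 : measurable_fun setT G1 by exact: measurable_funM.
  have mG2 : measurable_fun setT G2.
    apply: measurable_funM => //; apply: measurable_funM => //.
    by apply: measurable_funB => //; exact: measurable_snd.
  have -> : G = G1 \+ G2.
    by apply/funext => p; rewrite /G /G1 /G2 /dual_source /=; ring.
  have mink := @minkowski_EFin _ _ _ (lebesgue_rV n \x @lebesgue_measure R)%E _ _ 2 mG1 mG2.
  apply: le_trans (mink _) _; first by rewrite ler1n.
  rewrite [in leRHS]EFinD ge0_muleDl ?lee_fin ?mulr_ge0 ?powR_ge0 ?(ltW T0) ?(ltW CP0)//.
  apply: leeD.
    have N1 : ('N[lebesgue_rV n \x @lebesgue_measure R]_2%:E[EFin \o G1] <=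
       (1 * T `^ 2^-1)%:E * 'N[lebesgue_rV n]_2%:E[EFin \o phi])%E.
      apply: (@Lnorm2_prod_le _ _ _ (lebesgue_rV n) S T 1 G1 phi mS ST) => // p; rewrite /G1 normrM mul1r ger0_norm//.
    apply: (le_trans N1); rewrite mul1r mulrC EFinM -muleA.
    apply: lee_wpmul2l; first by rewrite lee_fin powR_ge0.
    by rewrite -(restr phi phiB).
  have N2 : ('N[lebesgue_rV n \x @lebesgue_measure R]_2%:E[EFin \o G2] <=
       (T * T `^ 2^-1)%:E * 'N[lebesgue_rV n]_2%:E[EFin \o laplacian phi])%E.
    apply: (@Lnorm2_prod_le _ _ _ (lebesgue_rV n) S T T G2 (laplacian phi) mS ST) => //; first exact: ltW.
    move=> p; rewrite /G2 indicE; have [pS|pS] := boolP (p.2 \in S); last first.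
      by rewrite !mul0r normr0 mulr0.
    rewrite !mul1r normrM ler_wpM2r//.
    move: pS => /set_mem; rewrite /S/= in_itv/= => /andP[p0 pT].
    by rewrite ler0_norm ?subr_le0 ?(ltW pT)// opprB gerBl (ltW p0).
  by rewrite /L /L2norm restr.
have U0 : (0 <= U)%E by exact: Lnorm_ge0.
have {}CS := le_trans CS (lee_wpmul2r U0 NG).
set X := `|_| in CS *.
have -> : (X%:E = (T^-1)%:E * (T * X)%:E)%E.
  by rewrite -EFinM mulrA mulVf ?gt_eqF// mul1r.
apply: (@le_trans _ _ ((T^-1)%:E * ((C_P * T `^ 2^-1 + T * T `^ 2^-1)%:E * L * U))%E).
  by apply: lee_wpmul2l => //; rewrite lee_fin invr_ge0 ltW.
rewrite -[(_ * L * U)%E]muleA [(L * U)%E]muleC !muleA -EFinM.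
have q0 : 0 < T `^ 2^-1 by rewrite powR_gt0.
have qT : T = T `^ 2^-1 * T `^ 2^-1.
  by rewrite -expr2 powR12_sqrt ?sqr_sqrtr ?(ltW T0).
rewrite powRN (_ : T^-1 * _ = C_P / T `^ 2^-1 + T `^ 2^-1)//.
move: (T `^ 2^-1) q0 qT => q q0 ->.
by field; rewrite gt_eqF.
Qed.

Lemma L2norm_le_H2norm n (B : set 'rV[R]_n) (g : jet2 R n) :
  (L2norm (lebesgue_rV n) B (jval g) <= H2norm B g)%E.
Proof.
apply: le_poweR_half; first exact: Lnorm_ge0.
rewrite -addeA leeDl// adde_ge0// sume_ge0// => i _; rewrite ?sume_ge0//.
all: by move=> *; rewrite expe_ge0// Lnorm_ge0.
Qed.

Lemma L2norm_hess_le_H2norm n (B : set 'rV[R]_n) (g : jet2 R n) i j :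
  (L2norm (lebesgue_rV n) B (jhess g i j) <= H2norm B g)%E.
Proof.
have sq0 (f : 'rV[R]_n -> R) : (0 <= L2norm (lebesgue_rV n) B f ^+ 2)%E.
  by rewrite expe_ge0// Lnorm_ge0.
apply: le_poweR_half; first exact: Lnorm_ge0.
apply: (@le_trans _ _ (\sum_(i < n) \sum_(j < n)
    L2norm (lebesgue_rV n) B (jhess g i j) ^+ 2)%E); last first.
  by rewrite leeDr// adde_ge0// sume_ge0.
rewrite (bigD1 i)//= (bigD1 j)//= -addeA leeDl// adde_ge0// sume_ge0// => k _.
  exact: sq0.
by apply: sume_ge0 => l _; exact: sq0.
Qed.

End test_function_bound.

(** * From test functions to H^2_0(B) *)

Section density.
Context {R : realType}.

Lemma restrict_mulr (X : Type) (B : set X) (f g : X -> R) :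
  (fun x => f x * g x) \_ B = (fun x => f x * (g \_ B) x).
Proof.
by apply/funext => x; rewrite !patchE; case: ifP => // _; rewrite mulr0.
Qed.

Lemma sume_const n (x : \bar R) : (0 <= x)%E ->
  (\sum_(i < n) x = n%:R%:E * x)%E.
Proof.
move=> x0; elim: n => [|n IH]; first by rewrite big_ord0 mul0e.
by rewrite big_ord_recr/= IH -natr1 EFinD ge0_muleDl ?lee_fin// mul1e.
Qed.

(** Each of the [n] diagonal Hessian differences is at most the H^2 distance. The crude factor [n]
    multiplies a quantity that will tend to 0, while the leading term keeps the exact constant 1. *)
Lemma laplacian_H2norm_bound n (B : set 'rV[R]_n) (g : jet2 R n) (phi : 'rV[R]_n -> R) :
  open B -> H20 B g -> test_function B phi -> (H20norm B g <= 1)%E ->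
  (L2norm (lebesgue_rV n) B (laplacian phi) <=
    1 + n%:R%:E * H2norm B (jet2_sub (jet2_of phi) g))%E.
Proof.
move=> oB [_ _ gh _] tphi g1.
have mB := open_measurable_rV oB.
have [M [_ _ c2 _ _ _ _ _]] := test_function_C2 tphi.
pose d i := (partial i (partial i phi) \- jhess g i i) \_ B.
have mh i : measurable_fun setT (jhess g i i \_ B).
  by have := gh i i; rewrite /in_L2 inE => /andP[/[!inE]].
have dE i : d i = (fun x => (partial i (partial i phi) \_ B) x - (jhess g i i \_ B) x).
  by apply/funext => x; rewrite /d !patchE; case: ifP; rewrite ?subr0.
have md i : measurable_fun setT (d i).
  rewrite dE; apply: measurable_funB => //.
  apply: (iffLR (measurable_restrictT _ mB)); apply: measurable_funTS.
  exact: continuous_measurable_rV.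
have lE : jlaplacian g \_ B = (fun x => \sum_(i < n) (jhess g i i \_ B) x).
  apply/funext => x; rewrite /jlaplacian patchE; case: ifPn => xB.
    by apply: eq_bigr => i _; rewrite patchE xB.
  by rewrite big1// => i _; rewrite patchE (negbTE xB).
have ml : measurable_fun setT (jlaplacian g \_ B).
  by rewrite lE; apply: measurable_sum.
have LE : laplacian phi \_ B = (jlaplacian g \_ B) \+ (fun x => \sum_(i < n) d i x).
  apply/funext => x; rewrite lE /= -big_split/= patchE /laplacian.
  case: ifPn => xB.
    by apply: eq_bigr => i _; rewrite dE !patchE xB addrC subrK.
  by rewrite big1// => i _; rewrite dE !patchE (negbTE xB) subrr addr0.
rewrite {1}/L2norm LE.
have ms : measurable_fun setT (fun x => \sum_(i < n) d i x) by exact: measurable_sum.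
have mink := @minkowski_EFin _ _ _ (lebesgue_rV n) _ _ 2 ml ms.
apply: le_trans (mink _) _; first by rewrite ler1n.
apply: leeD; first exact: g1.
apply: (le_trans (Lnorm2_sum _ _ md)).
apply: (@le_trans _ _ (\sum_(i < n) H2norm B (jet2_sub (jet2_of phi) g))%E).
  apply: lee_sum => i _.
  exact: (@L2norm_hess_le_H2norm _ _ B (jet2_sub (jet2_of phi) g) i i).
by rewrite sume_const// poweR_ge0.
Qed.

End density.

Theorem theorem1p3 (R : realType) (n : nat) (hn : (1 <= n)%N)
    (T : R) (hT : 0 < T)
    (B : set 'rV[R]_n) (hBb : bounded_set B) (hBo : open B)
    (C_P : R) (hCP : 0 < C_P)
    (hPoincare : forall phi : 'rV[R]_n -> R, test_function B phi ->
      (L2norm (lebesgue_rV n) B phi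
       <= C_P%:E * L2norm (lebesgue_rV n) B (laplacian phi))%E)
    (u0 : 'rV[R]_n -> R) (hu0 : u0 \in Lfun (lebesgue_rV n) 2%:E)
    (hsupp : ess_support u0 `<=` B)
    (u : 'rV[R]_n -> R -> R)
    (hu : forall (y : 'rV[R]_n) (t : R), 0 < t < T ->
      u y t = heat_semigroup t u0 y) :
  (Hm2norm B (L2_functional B u0)
   <= (C_P * T `^ (- 2^-1) + T `^ (2^-1))%:E
      * L2norm (lebesgue_rV n \x @lebesgue_measure R) (B `*` `]0%R, T[%classic)
          (fun yt => u yt.1 yt.2))%E.
Proof.
have test phi tphi := heat_test_bound hT hBo hCP tphi (hPoincare phi tphi) hu0 hu.
move: test; set U := L2norm _ (B `*` _) _; set C : R := _ + _ => test.
have C0 : 0 < C by rewrite addr_gt0 ?mulr_gt0 ?powR_gt0.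
have U0 : (0 <= U)%E by exact: Lnorm_ge0.
have mu0 : measurable_fun setT u0 by move: hu0; rewrite inE => /andP[/[!inE]].
apply: ge_ereal_sup => _ [g [Hg g1] <-].
(* An infinite [U] makes the right-hand side infinite because [C > 0]; from here on the norm of [u]
   is a real [r]. *)
have [->|Uy] := eqVneq U +oo%E; first by rewrite gt0_muley ?lte_fin// leey.
have /fineK : U \is a fin_num by rewrite ge0_fin_numE// ltey.
have : 0 <= fine U by exact: fine_ge0.
move: (fine U) => r r0 rU; rewrite -rU in test *.
have [v v0 vE] : exists2 v : R, 0 <= v & Lnorm (lebesgue_rV n) 2%:E (EFin \o u0) = v%:E.
  have N0 := Lnorm_ge0 (lebesgue_rV n) 2%:E (EFin \o u0).
  exists (fine (Lnorm (lebesgue_rV n) 2%:E (EFin \o u0))); first exact: fine_ge0.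
  rewrite fineK// ge0_fin_numE//.
  by move: hu0; rewrite inE => /andP[_ /[!inE]].
have [g0 _ _ [phi_ [tphi /fine_cvgP[finphi cvgphi]]]] := Hg.
(* [g] is replaced by [phi_ k]: the test-function estimate bounds the main term, and the replacement
   error is at most [v], the L^2 norm of [u0], times the H^2 distance. *)
have step k : (`|L2_functional B u0 g|%:E <=
   (C * r)%:E * (1 + n%:R%:E * H2norm B (jet2_sub (jet2_of (phi_ k)) g))
   + v%:E * H2norm B (jet2_sub (jet2_of (phi_ k)) g))%E.
  set h := jet2_sub _ _.
  have [M C2] := test_function_C2 (tphi k).
  have ig : (lebesgue_rV n).-integrable setT (EFin \o (fun x => u0 x * (jval g \_ B) x)).
    by apply/Lfun1_integrable; exact: Lfun2_mul_Lfun1.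
  have iphi := Lfun2_mul_C2_integrable hu0 C2.
  have phiB : phi_ k \_ B = phi_ k.
    apply/funext => x; rewrite patchE; case: ifPn => // /negP; rewrite inE => xB.
    by rewrite (test_function0 (tphi k)).
  have mh : measurable_fun setT (jval h \_ B).
    have c0 : continuous (phi_ k) by case: C2.
    have mg : measurable_fun setT (jval g \_ B) by move: g0; rewrite /in_L2 inE => /andP[/[!inE]].
    rewrite (_ : jval h \_ B = fun x => phi_ k x - (jval g \_ B) x).
      by apply: measurable_funB => //; exact: continuous_measurable_rV.
    apply/funext => x; rewrite -{1}phiB !patchE /h/=; case: ifP; rewrite ?subr0//.
  have -> : L2_functional B u0 g = \int[lebesgue_rV n]_(x in B) (u0 x * phi_ k x)
      - \int[lebesgue_rV n]_x (u0 x * (jval h \_ B) x).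
    have hE x : u0 x * (jval h \_ B) x = u0 x * phi_ k x - u0 x * (jval g \_ B) x.
      by rewrite -[in RHS]phiB !patchE /h/=; case: ifP; rewrite ?mulr0 ?subr0// mulrBr.
    rewrite /L2_functional 2!(Rintegral_mkcond _ B) 2!restrict_mulr phiB.
    by under [X in _ - X]eq_Rintegral do rewrite hE; rewrite RintegralB// opprB addrC subrK.
  apply: (@le_trans _ _ (`|\int[lebesgue_rV n]_(x in B) (u0 x * phi_ k x)|%:E +
     `|\int[lebesgue_rV n]_x (u0 x * (jval h \_ B) x)|%:E)%E).
    by rewrite -EFinD lee_fin ler_normB.
  apply: leeD.
    apply: (le_trans (test _ (tphi k))); apply: lee_wpmul2l.
      by rewrite lee_fin mulr_ge0// ltW.
    exact: laplacian_H2norm_bound.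
  apply: (le_trans (Cauchy_Schwarz_Rintegral _ mu0 mh)); rewrite vE.
  apply: lee_wpmul2l; first by rewrite lee_fin.
  exact: (L2norm_le_H2norm B h).
apply/lee_addgt0Pr => e e0.
(* [C * r * n + v] is the total coefficient of the H^2 distance in [step]; adding 1 allows division
   by [K]. *)
pose K := C * r * n%:R + v + 1.
have K0 : 0 < K by rewrite ltr_wpDl// addr_ge0// !mulr_ge0// ltW.
have eK0 : 0 < e / K by rewrite divr_gt0.
have /cvgrPdist_le/(_ _ eK0) near0 := cvgphi.
(* The distance is an extended real, so an index is chosen at which it is both finite and at most
   [e / K]. *)
have [k [fk]] := filter_ex (filterI finphi near0).
have := step k; move: fk => /=; set eta := H2norm _ _ => /fineK.
have : 0 <= fine eta by rewrite fine_ge0// poweR_ge0.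
move: (fine eta) => x x0 <- /[swap]; rewrite sub0r normrN (ger0_norm x0) => xe.
rewrite (_ : (_ * (1 + _) + _)%E = (C * r * (1 + n%:R * x) + v * x)%:E)//.
rewrite (_ : (_ + e%:E)%E = (C * r + e)%:E)// !lee_fin => /le_trans; apply.
have : x * K <= e by rewrite -ler_pdivlMr.
rewrite /K => xK; rewrite mulrDr mulr1 -addrA lerD2l (le_trans _ xK)//.
rewrite [leRHS](_ : _ = C * r * (n%:R * x) + v * x + x); last by ring.
by rewrite lerDl.
Qed.
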